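(* Let $D=(\alpha,\beta)_{\mathbb Q}$ be a quaternion division algebra and $p\neq 2$ a prime with $v_p(\alpha)=v_p(\beta)=0$, where $\alpha$ is a square in $\mathbb Q_p$ and where, if $-1$ has a square root in $D$, $\beta=-1$. Identify $G_p$ with $\mathrm{SL}_2(\mathbb Q_p)$ via the isomorphism $x_1+x_2e_2+x_3e_3+x_4e_4\mapsto\begin{pmatrix}x_1+x_2\sqrt\alpha & \beta(x_3+x_4\sqrt\alpha)\\ x_3-x_4\sqrt\alpha & x_1-x_2\sqrt\alpha\end{pmatrix}$, so that the norm-1 group $G$ of $D$ acts on the tree $\Delta_p$. Then the following are equivalent: (i) $-1$ has a square root in $D$; (ii) $G$ contains an element that stabilizes the standard apartment $\Sigma_0$ and acts on it as a reflection; (iii) the action of $G$ on $\Delta_p$ is strongly transitive with respect to some apartment system.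
   Context: $(\alpha,\beta)_{\mathbb Q}$ has basis $1,e_2,e_3,e_4$ with $e_2^2=\alpha$, $e_3^2=\beta$, $e_2e_3=-e_3e_2=e_4$ and norm $N(x)=x_1^2-\alpha x_2^2-\beta x_3^2+\alpha\beta x_4^2$; $G$, $G_p$ are the norm-1 groups of $D$ and $D_p=D\otimes\mathbb Q_p$. $\Delta_p$ is the Bruhat–Tits tree of $\mathrm{SL}_2(\mathbb Q_p)$ (vertices: homothety classes of $\mathbb Z_p$-lattices in $\mathbb Q_p^2$, adjacent if representatives satisfy $L\supset L'\supset pL$), a building with chambers the edges and infinite dihedral Weyl group; apartments are the bi-infinite lines. The standard apartment $\Sigma_0$ is the line with vertices $[\mathbb Z_p\oplus p^n\mathbb Z_p]$, $n\in\mathbb Z$; its stabilizer in $\mathrm{SL}_2(\mathbb Q_p)$ is the monomial group, with diagonal matrices acting as translations and non-diagonal monomial matrices as reflections. An apartment system is a set $\mathcal A$ of apartments such that any two chambers lie in a common member of $\mathcal A$; the action is strongly transitive with respect to a $G$-invariant apartment system $\mathcal A$ if $G$ is transitive on pairs $(\Sigma,C)$ with $\Sigma\in\mathcal A$ and $C$ an edge of $\Sigma$. *)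

(* Defs.v *)
From HB Require Import structures.
From mathcomp Require Import all_boot all_order all_algebra.
From mathcomp Require Import boolp classical_sets.
Set Implicit Arguments. Unset Strict Implicit. Unset Printing Implicit Defensive.
Import Order.TTheory GRing.Theory Num.Theory.
Local Open Scope ring_scope.
Local Open Scope classical_set_scope.

Definition vp (p : nat) (q : rat) : int :=
  (logn p (absz (numq q)))%:Z - (logn p (absz (denq q)))%:Z.

(* Q_p, characterised up to isomorphism as the completion of (Q, v_p): *)
(* a field F with a discrete valuation v (defined on nonzero elements) *)
(* into which Q embeds (via ratr), v restricting to v_p, Q dense in F, *)
(* and F complete.                                                     *)
Definition vclose (F : fieldType) (v : F -> int) (n : int) (x y : F) : Prop :=
  x - y = 0 \/ n <= v (x - y).

Definition vcauchy (F : fieldType) (v : F -> int) (u : nat -> F) : Prop :=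
  forall n : int, exists N : nat, forall i j : nat, (N <= i)%N -> (N <= j)%N ->
    vclose v n (u i) (u j).

Definition vconverges (F : fieldType) (v : F -> int) (u : nat -> F) (l : F) : Prop :=
  forall n : int, exists N : nat, forall i : nat, (N <= i)%N -> vclose v n (u i) l.

Definition padic_field (p : nat) (F : fieldType) (v : F -> int) : Prop :=
  [/\ (forall x y : F, x != 0 -> y != 0 -> v (x * y) = v x + v y),
      (forall x y : F, x != 0 -> y != 0 -> x + y != 0 ->
          Num.min (v x) (v y) <= v (x + y)),
      (forall q : rat, q != 0 -> ratr q != 0 :> F /\ v (ratr q) = vp p q),
      (forall (x : F) (n : int), exists q : rat, vclose v n x (ratr q)) &
      (forall u : nat -> F, vcauchy v u -> exists l, vconverges v u l)].

(* The quaternion algebra (alpha, beta)_Q, basis 1, e2, e3, e4         *)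
Record quat := Quat { x1 : rat; x2 : rat; x3 : rat; x4 : rat }.

Definition qone : quat := Quat 1 0 0 0.
Definition qzero : quat := Quat 0 0 0 0.
Definition qmone : quat := Quat (-1) 0 0 0.

(* e2^2 = alpha, e3^2 = beta, e2 e3 = - e3 e2 = e4 *)
Definition qmul (alpha beta : rat) (x y : quat) : quat :=
  Quat (x1 x * x1 y + alpha * x2 x * x2 y + beta * x3 x * x3 y
          - alpha * beta * x4 x * x4 y)
       (x1 x * x2 y + x2 x * x1 y - beta * x3 x * x4 y + beta * x4 x * x3 y)
       (x1 x * x3 y + x3 x * x1 y + alpha * x2 x * x4 y - alpha * x4 x * x2 y)
       (x1 x * x4 y + x4 x * x1 y + x2 x * x3 y - x3 x * x2 y).

Definition qnorm (alpha beta : rat) (x : quat) : rat :=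
  x1 x ^+ 2 - alpha * x2 x ^+ 2 - beta * x3 x ^+ 2 + alpha * beta * x4 x ^+ 2.

Definition quat_division (alpha beta : rat) : Prop :=
  forall x : quat, x <> qzero ->
    exists y, qmul alpha beta x y = qone /\ qmul alpha beta y x = qone.

Definition sqrt_m1_in_D (alpha beta : rat) : Prop :=
  exists x : quat, qmul alpha beta x x = qmone.

Definition normone (alpha beta : rat) : set quat :=
  [set x | qnorm alpha beta x = 1].

(* The embedding G -> SL_2(Q_p), for a chosen square root s of alpha   *)
Definition mx2 (F : nzRingType) (a b c d : F) : 'M[F]_2 :=
  \matrix_(i < 2, j < 2)
    (if (i : nat) == 0%N then (if (j : nat) == 0%N then a else b)
     else (if (j : nat) == 0%N then c else d)).

Definition rho (F : fieldType) (beta : rat) (s : F) (x : quat) : 'M[F]_2 :=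
  mx2 (ratr (x1 x) + ratr (x2 x) * s) (ratr beta * (ratr (x3 x) + ratr (x4 x) * s))
      (ratr (x3 x) - ratr (x4 x) * s) (ratr (x1 x) - ratr (x2 x) * s).

Section Tree.
Variables (p : nat) (F : fieldType) (v : F -> int).

Definition inO (x : F) : Prop := x = 0 \/ 0 <= v x.

Definition stdlat : set 'cV[F]_2 := [set u | forall i, inO (u i 0)].
Definition lat (g : 'M[F]_2) : set 'cV[F]_2 := [set g *m u | u in stdlat].

Definition is_lattice (L : set 'cV[F]_2) : Prop :=
  exists g : 'M[F]_2, g \in unitmx /\ L = lat g.

Definition hclass (L : set 'cV[F]_2) : set (set 'cV[F]_2) :=
  [set L' | exists c : F, c != 0 /\ L' = [set c *: u | u in L]].

Definition vertex := set (set 'cV[F]_2).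

Definition is_vertex (X : vertex) : Prop :=
  exists L, is_lattice L /\ X = hclass L.

Definition adjacent (X Y : vertex) : Prop :=
  [/\ is_vertex X, is_vertex Y &
   exists L L', [/\ X L, Y L', (L' `<=` L /\ L' <> L) &
                    ([set (p%:R : F) *: u | u in L] `<=` L' /\
                     [set (p%:R : F) *: u | u in L] <> L')]].

Definition chamber (C : set vertex) : Prop :=
  exists X Y, adjacent X Y /\ C = [set X] `|` [set Y].

Definition line (f : int -> vertex) : Prop :=
  injective f /\ forall n : int, adjacent (f n) (f (n + 1)).

Definition is_apartment (A : set vertex) : Prop :=
  exists f, line f /\ A = range f.

Definition apt_edge (A : set vertex) (C : set vertex) : Prop :=
  exists f, [/\ line f, A = range f &
                exists n : int, C = [set f n] `|` [set f (n + 1)]].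

Definition apartment_system (AS : set (set vertex)) : Prop :=
  (forall A, AS A -> is_apartment A) /\
  (forall C C', chamber C -> chamber C' ->
     exists A, [/\ AS A, apt_edge A C & apt_edge A C']).

Definition act (g : 'M[F]_2) (X : vertex) : vertex :=
  [set [set g *m u | u in L] | L in X].

Definition strongly_transitive (Gam : set 'M[F]_2) (AS : set (set vertex)) : Prop :=
  [/\ apartment_system AS,
      (forall g A, Gam g -> AS A -> AS (act g @` A)) &
      (forall A C A' C', AS A -> apt_edge A C -> AS A' -> apt_edge A' C' ->
         exists g, [/\ Gam g, act g @` A = A' & act g @` C = C'])].

Definition sig0 (n : int) : vertex := hclass (lat (mx2 1 0 0 ((p%:R : F) ^ n))).
Definition Sigma0 : set vertex := range sig0.

End Tree.

(* Main.v *)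
Require Import Defs.
From HB Require Import structures.
From mathcomp Require Import all_boot all_order all_algebra.
From mathcomp Require Import boolp classical_sets.
From mathcomp Require Import zify ring.
Import Order.TTheory GRing.Theory Num.Theory.
Local Open Scope ring_scope.
Local Open Scope classical_set_scope.
Set Implicit Arguments. Unset Strict Implicit. Unset Printing Implicit Defensive.

(* A homothety class of lattices is the class of [g O^2] for some invertible [g], *)
(* and the classes of [g O^2] and [h O^2] agree iff [h^-1 g] lies in F^* GL_2(O); *)
(* every finite path without backtracking is an [h]-translate of a segment of     *)
(* Sigma_0.  If an element [g] of determinant 1 swaps two vertices at distance    *)
(* [2 k], then conjugating by such an [h] shows that [v(tr g) >= k]; hence an     *)
(* element of G reflecting any apartment has trace 0, so that it squares to -1.   *)
(* A strongly transitive action provides such an element, because translations    *)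
(* by an odd amount are excluded by the determinant.                              *)
(* Conversely, when [beta = -1] the element [e_3] reflects Sigma_0, and the       *)
(* translates of Sigma_0 under G form an apartment system: weak approximation     *)
(* (G is dense in SL_2(Q_p)) moves any two chambers into Sigma_0, and the         *)
(* stabilizer of Sigma_0 contains, next to [e_3], the norm one element            *)
(* [y^2 / N(y)] with [y = q + e_2], [q] a rational close to [p^m - s], which      *)
(* translates by [2 m].                                                           *)

(** The trace links algebra and geometry: [x1 x] is half the trace of [rho x], and an [x] of norm 1
    with [x1 x = 0] satisfies [x^2 = -1]. A reflection of a line about one of its vertices swaps
    vertices at every even distance [2 n], so [latclass_swap] makes its trace divisible by all
    powers of [p], hence zero ([reflection_sqrt]). A reflection without a fixed vertex would move a
    vertex by an odd distance, which determinant 1 forbids ([latclass_parity]). As [line_path] moves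
    any segment of any line into Sigma_0, the argument needs no knowledge of the apartment system in
    (iii). For the converse the system is a single G-orbit, that of Sigma_0. Strong transitivity
    thus reduces to the edges of Sigma_0 ([edge_transitive]). That two chambers share an apartment
    is reduced to determinant 1 by [two_chambers] and then to G by [approx_SL2]: only finitely many
    vertices are concerned, and a small perturbation of a matrix does not change its action on
    them. *)

(** * Valuations *)

Section Valuation.
Variables (p : nat) (F : fieldType) (v : F -> int).
Hypothesis HF : padic_field p v.

(** The value [v 0] is unspecified; listing [x = 0] apart amounts to the convention that 0 has
    infinite valuation. *)
Definition vge (n : int) (x : F) : Prop := x = 0 \/ n <= v x.

Lemma vM x y : x != 0 -> y != 0 -> v (x * y) = v x + v y.
Proof. by case: HF => + _ _ _ _; apply. Qed.

Lemma v1 : v 1 = 0.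
Proof.
by apply: (addrI (v 1)); rewrite addr0 -vM ?oner_neq0 // mulr1.
Qed.

Lemma vN x : v (- x) = v x.
Proof.
have [->|x0] := eqVneq x 0; first by rewrite oppr0.
have m0 : -1 != 0 :> F by rewrite oppr_eq0 oner_eq0.
have h : v (-1) = 0 by have := vM m0 m0; rewrite mulrNN mulr1 v1; move: (v (-1)) => a e; lia.
by rewrite -mulN1r vM // h add0r.
Qed.

Lemma vV x : x != 0 -> v x^-1 = - v x.
Proof.
move=> x0; have xV0 : x^-1 != 0 by rewrite invr_eq0.
by have := vM x0 xV0; rewrite divff // v1 => e; lia.
Qed.

Lemma vge_0 n : vge n 0. Proof. by left. Qed.

Lemma vge_v x : vge (v x) x. Proof. by right. Qed.

Lemma vge_le n m x : m <= n -> vge n x -> vge m x.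
Proof. by move=> mn [->|h]; [left|right; lia]. Qed.

Lemma vgeN n x : vge n x -> vge n (- x).
Proof. by move=> [->|h]; [rewrite oppr0; left|right; rewrite vN]. Qed.

Lemma vgeD n x y : vge n x -> vge n y -> vge n (x + y).
Proof.
move=> [->|hx]; first by rewrite add0r.
move=> [->|hy]; first by rewrite addr0; right.
have [->|x0] := eqVneq x 0; first by rewrite add0r; right.
have [->|y0] := eqVneq y 0; first by rewrite addr0; right.
have [->|xy0] := eqVneq (x + y) 0; first by left.
case: HF => _ + _ _ _ => /(_ x y x0 y0 xy0) h; right; lia.
Qed.

Lemma vgeB n x y : vge n x -> vge n y -> vge n (x - y).
Proof. by move=> hx /vgeN; apply: vgeD. Qed.

Lemma vgeM n m x y : vge n x -> vge m y -> vge (n + m) (x * y).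
Proof.
move=> [->|hx]; first by rewrite mul0r; left.
move=> [->|hy]; first by rewrite mulr0; left.
have [->|x0] := eqVneq x 0; first by rewrite mul0r; left.
have [->|y0] := eqVneq y 0; first by rewrite mulr0; left.
by right; rewrite vM //; lia.
Qed.

Lemma vgeM_le k n m x y : k <= n + m -> vge n x -> vge m y -> vge k (x * y).
Proof. by move=> h hx hy; apply: vge_le h _; apply: vgeM. Qed.

Lemma vge_all x : (forall n : nat, vge n%:Z x) -> x = 0.
Proof.
move=> h; have := h (absz (v x)).+1; case=> // h'; lia.
Qed.

(** The ultrametric principle that the term of strictly smaller valuation governs a sum: otherwise
    [x = (x + y) - y] would have valuation above its own. *)
Lemma v_dominant x y : x != 0 -> vge (v x + 1) y -> x + y != 0 /\ v (x + y) = v x.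
Proof.
move=> x0 hy.
have hx : ~ vge (v x + 1) x by case=> [h|h]; [rewrite h eqxx in x0|lia].
have xy0 : x + y != 0.
  apply/eqP => e; apply: hx; have xE : x = - y by rewrite -[LHS](addrK y) e add0r.
  by rewrite {2}xE; exact: vgeN.
split=> //.
have h1 : vge (v x) (x + y).
  by apply: vgeD; [right|apply: vge_le hy; lia].
case: h1 => [e|h1]; first by rewrite e eqxx in xy0.
have h2 : ~ (vge (v x + 1) (x + y)).
  by move=> h; apply: hx; have := vgeB h hy; rewrite addrK.
have [h3|h3] := lerP (v x + 1) (v (x + y)); last by lia.
by case: h2; right.
Qed.

Lemma vratr (q : rat) : q != 0 -> ratr q != 0 :> F /\ v (ratr q) = vp p q.
Proof. by case: HF => _ _ + _ _; apply. Qed.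

Lemma ratr_neq0 (q : rat) : q != 0 -> ratr q != 0 :> F.
Proof. by case/vratr. Qed.

Lemma natr_neq0 n : (n != 0)%N -> n%:R != 0 :> F.
Proof.
move=> n0; have q0 : n%:R != 0 :> rat by rewrite pnatr_eq0.
by have [] := vratr q0; rewrite ratr_nat.
Qed.

Lemma v_nat n : (n != 0)%N -> v n%:R = (logn p n)%:Z.
Proof.
move=> n0; have q0 : n%:R != 0 :> rat by rewrite pnatr_eq0.
have [_] := vratr q0; rewrite ratr_nat => ->.
by rewrite /vp pmulrn numq_int denq_int /= logn1 subr0.
Qed.

Hypothesis p_pr : prime p.

Lemma pi_neq0 : p%:R != 0 :> F.
Proof. by apply: natr_neq0; rewrite -lt0n prime_gt0. Qed.

Lemma v_pi : v p%:R = 1.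
Proof. by rewrite v_nat -?lt0n ?prime_gt0 // logn_prime // eqxx. Qed.

Lemma piX_neq0 (n : int) : p%:R ^ n != 0 :> F.
Proof. by rewrite expfz_neq0 // pi_neq0. Qed.

Lemma v_piX (n : int) : v (p%:R ^ n) = n.
Proof.
have h (k : nat) : v (p%:R ^+ k) = k%:Z.
  elim: k => [|k IH]; first by rewrite expr0 v1.
  by rewrite exprS vM ?expf_neq0 ?pi_neq0 // v_pi IH; lia.
case: n => n; first exact: h.
by rewrite NegzE -exprnN vV ?expf_neq0 ?pi_neq0 // h.
Qed.

Lemma int_neq0 (z : int) : z != 0 -> z%:~R != 0 :> F.
Proof.
move=> z0; have q0 : z%:~R != 0 :> rat by rewrite intr_eq0.
by have [] := vratr q0; rewrite ratr_int.
Qed.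

(** Reduction to lowest terms can be undone in [F] because nonzero integers stay nonzero there, by
    [padic_field]. From this [ratr] is seen to be a field morphism, although [F] carries no
    order. *)
Lemma ratr_frac (n d : int) : d != 0 ->
  ratr (n%:~R / d%:~R) = n%:~R / d%:~R :> F.
Proof.
move=> d0; rewrite [LHS]/ratr; set q := _ / _ : rat.
have e : (numq q * d = n * denq q)%R.
  apply: (@intr_inj rat); rewrite !intrM.
  have := divq_num_den q; rewrite {2}/q => e.
  have dq : (denq q)%:~R != 0 :> rat by rewrite intr_eq0 denq_neq0.
  have dr : d%:~R != 0 :> rat by rewrite intr_eq0.
  by apply/eqP; rewrite -eqr_div //; apply/eqP.
apply/eqP; rewrite eqr_div ?int_neq0 ?denq_neq0 //.
by rewrite -!intrM e.
Qed.

Lemma ratrD x y : ratr (x + y) = ratr x + ratr y :> F.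
Proof.
have dx : denq x != 0 by rewrite denq_neq0.
have dy : denq y != 0 by rewrite denq_neq0.
have e : x + y = (numq x * denq y + numq y * denq x)%:~R / (denq x * denq y)%:~R.
  by rewrite -[in LHS](divq_num_den x) -[in LHS](divq_num_den y) addf_div ?intr_eq0 //
     intrD !intrM.
rewrite e ratr_frac ?mulf_neq0 // /ratr addf_div ?int_neq0 //.
by rewrite intrD !intrM.
Qed.

Lemma ratrM x y : ratr (x * y) = ratr x * ratr y :> F.
Proof.
have dx : denq x != 0 by rewrite denq_neq0.
have dy : denq y != 0 by rewrite denq_neq0.
have e : x * y = (numq x * numq y)%:~R / (denq x * denq y)%:~R.
  by rewrite -[in LHS](divq_num_den x) -[in LHS](divq_num_den y) mulf_div !intrM.
by rewrite e ratr_frac ?mulf_neq0 // /ratr mulf_div !intrM.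
Qed.

Lemma ratr0 : ratr 0 = 0 :> F. Proof. exact: (ratr_int _ 0). Qed.
Lemma ratr1 : ratr 1 = 1 :> F. Proof. exact: (ratr_int _ 1). Qed.
Lemma ratrN x : ratr (- x) = - ratr x :> F.
Proof. by apply/eqP; rewrite -addr_eq0 -ratrD addNr ratr0. Qed.
Lemma ratrB x y : ratr (x - y) = ratr x - ratr y :> F.
Proof. by rewrite ratrD ratrN. Qed.
Lemma ratrX x n : ratr (x ^+ n) = ratr x ^+ n :> F.
Proof. by elim: n => [|n IH]; rewrite ?expr0 ?ratr1 // !exprS ratrM IH. Qed.
Lemma ratr_inj : injective (ratr : rat -> F).
Proof.
move=> x y e; apply/eqP; rewrite -subr_eq0; apply: contraT => /vratr [].
by rewrite ratrB e subrr eqxx.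
Qed.
Lemma rat_dense (x : F) (n : int) : exists q : rat, vge n (ratr q - x).
Proof.
case: HF => _ _ _ + _ => /(_ x n) [q h]; exists q.
by rewrite -opprB; apply: vgeN.
Qed.

End Valuation.

(** * Two by two matrices, entry by entry *)

Section Mx2.
Variable F : fieldType.
Implicit Types (a b c d k : F) (A B : 'M[F]_2).

Lemma ord2P (P : 'I_2 -> Prop) : P 0 -> P 1 -> forall i, P i.
Proof.
move=> h0 h1 [[|[|//]] h].
  by rewrite (_ : Ordinal h = 0) //; apply/val_inj.
by rewrite (_ : Ordinal h = 1) //; apply/val_inj.
Qed.

Lemma mx2_eq A B : A 0 0 = B 0 0 -> A 0 1 = B 0 1 -> A 1 0 = B 1 0 -> A 1 1 = B 1 1 -> A = B.
Proof. by move=> h1 h2 h3 h4; apply/matrixP; do 2![apply: ord2P]. Qed.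

Lemma mx2_00 a b c d : mx2 a b c d 0 0 = a. Proof. by rewrite mxE. Qed.
Lemma mx2_01 a b c d : mx2 a b c d 0 1 = b. Proof. by rewrite mxE. Qed.
Lemma mx2_10 a b c d : mx2 a b c d 1 0 = c. Proof. by rewrite mxE. Qed.
Lemma mx2_11 a b c d : mx2 a b c d 1 1 = d. Proof. by rewrite mxE. Qed.
Definition mx2E := (mx2_00, mx2_01, mx2_10, mx2_11).

Lemma mx2_eta A : A = mx2 (A 0 0) (A 0 1) (A 1 0) (A 1 1).
Proof. by apply: mx2_eq; rewrite mx2E. Qed.

Lemma mulmx2E A B (i j : 'I_2) : (A *m B) i j = A i 0 * B 0 j + A i 1 * B 1 j.
Proof. by rewrite mxE big_ord_recl big_ord1; congr (_ + A _ _ * B _ _); apply/val_inj. Qed.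

Lemma mul_mx2 a b c d a' b' c' d' :
  mx2 a b c d *m mx2 a' b' c' d' =
  mx2 (a * a' + b * c') (a * b' + b * d') (c * a' + d * c') (c * b' + d * d').
Proof. by apply: mx2_eq; rewrite mulmx2E !mx2E. Qed.

Lemma scale_mx2 k a b c d : k *: mx2 a b c d = mx2 (k * a) (k * b) (k * c) (k * d).
Proof. by apply: mx2_eq; rewrite mxE !mx2E. Qed.

Lemma add_mx2 a b c d a' b' c' d' :
  mx2 a b c d + mx2 a' b' c' d' = mx2 (a + a') (b + b') (c + c') (d + d').
Proof. by apply: mx2_eq; rewrite mxE !mx2E. Qed.

Lemma scalar_mx2 k : k%:M = mx2 k 0 0 k.
Proof. by apply: mx2_eq; rewrite mxE !mx2E. Qed.

Lemma det_mx2E A : \det A = A 0 0 * A 1 1 - A 0 1 * A 1 0.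
Proof.
rewrite (expand_det_row _ 0) big_ord_recl big_ord1 /cofactor !det_mx11 !mxE /=.
have -> : lift 0 0 = 1 :> 'I_2 by apply/val_inj.
have -> : lift 1 0 = 0 :> 'I_2 by apply/val_inj.
by rewrite /= expr0 expr1; ring.
Qed.

Lemma det_mx2 a b c d : \det (mx2 a b c d) = a * d - b * c.
Proof. by rewrite det_mx2E !mx2E. Qed.

Lemma trace_mx2 a b c d : \tr (mx2 a b c d) = a + d.
Proof.
rewrite /mxtrace big_ord_recl big_ord1 mx2_00.
have -> : lift 0 0 = 1 :> 'I_2 by apply/val_inj.
by rewrite mx2_11.
Qed.

Lemma unitmx2 A : (A \in unitmx) = (\det A != 0).
Proof. by rewrite unitmxE unitfE. Qed.

Lemma invmx2 A : A \in unitmx ->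
  invmx A = (\det A)^-1 *: mx2 (A 1 1) (- A 0 1) (- A 1 0) (A 0 0).
Proof.
move=> uA; apply: (can_inj (mulKmx uA)); rewrite mulmxV // -scalemxAr.
rewrite [in X in _ *: X](mx2_eta A) mul_mx2 scale_mx2 scalar_mx2.
have d0 : \det A != 0 by rewrite -unitmx2.
rewrite !mx2E; move: d0; rewrite det_mx2E => d0.
by congr mx2; field.
Qed.

End Mx2.

(** * Lattice classes *)

Section Lattices.
Variables (p : nat) (F : fieldType) (v : F -> int).
Hypothesis HF : padic_field p v.
Implicit Types (g h K E : 'M[F]_2).

Definition intM m n (A : 'M[F]_(m, n)) := forall i j, vge v 0 (A i j).

Definition GL2O K := [/\ intM K, \det K != 0 & v (\det K) = 0].

Lemma vge_sum I (r : seq I) (G : I -> F) n :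
  (forall i, vge v n (G i)) -> vge v n (\sum_(i <- r) G i).
Proof.
move=> h; elim/big_ind: _ => // [|x y]; [exact: vge_0|exact: (vgeD HF)].
Qed.

Lemma intM_mul m n k (A : 'M[F]_(m, n)) (B : 'M[F]_(n, k)) :
  intM A -> intM B -> intM (A *m B).
Proof.
move=> hA hB i j; rewrite mxE; apply: vge_sum => l.
by rewrite -[0]addr0; apply: (vgeM HF).
Qed.

Lemma intM_mx2 a b c d :
  vge v 0 a -> vge v 0 b -> vge v 0 c -> vge v 0 d -> intM (mx2 a b c d).
Proof. by move=> ha hb hc hd; do 2![apply: ord2P]; rewrite mx2E. Qed.

Lemma vge_det K : intM K -> vge v 0 (\det K).
Proof.
by move=> h; rewrite det_mx2E; apply: (vgeB HF); rewrite -[0]addr0; apply: (vgeM HF).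
Qed.

Lemma GL2O_unitmx K : GL2O K -> K \in unitmx.
Proof. by case=> _ h _; rewrite unitmx2. Qed.

Lemma GL2O_mul K K' : GL2O K -> GL2O K' -> GL2O (K *m K').
Proof.
move=> [h1 h2 h3] [k1 k2 k3]; split; first exact: intM_mul.
  by rewrite det_mulmx mulf_neq0.
by rewrite det_mulmx (vM HF) // h3 k3 addr0.
Qed.

Lemma GL2O_inv K : GL2O K -> GL2O (invmx K).
Proof.
move=> hK; have uK := GL2O_unitmx hK; case: hK => h1 h2 h3; split.
- rewrite invmx2 // scale_mx2.
  have h : vge v 0 (\det K)^-1 by right; rewrite (vV HF) // h3.
  by apply: intM_mx2; rewrite -[0]addr0; apply: (vgeM HF) => //; apply: (vgeN HF).
- by rewrite det_inv invr_eq0.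
- by rewrite det_inv (vV HF) // h3.
Qed.

Lemma GL2O_of_int K : K \in unitmx -> intM K -> intM (invmx K) -> GL2O K.
Proof.
move=> uK h h'; have d0 : \det K != 0 by rewrite -unitmx2.
split=> //; have := vge_det h; have := vge_det h'; rewrite det_inv.
case=> [/eqP|]; rewrite ?invr_eq0; first by rewrite (negPf d0).
rewrite (vV HF) // => a [/eqP|b]; first by rewrite (negPf d0).
by move: a b; set t := v _; lia.
Qed.

Lemma GL2O_mx2 a b c d : vge v 0 a -> vge v 0 b -> vge v 0 c -> vge v 0 d ->
  a * d - b * c != 0 -> v (a * d - b * c) = 0 -> GL2O (mx2 a b c d).
Proof. by move=> *; split; rewrite ?det_mx2 //; apply: intM_mx2. Qed.

Lemma GL2O_1 : GL2O 1%:M.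
Proof.
rewrite scalar_mx2; apply: GL2O_mx2; rewrite ?mulr0 ?subr0 ?mulr1 ?oner_neq0 ?(v1 HF) //.
- by right; rewrite (v1 HF).
- exact: vge_0.
- exact: vge_0.
- by right; rewrite (v1 HF).
Qed.

(** Inclusion can be tested on the columns of [g], which generate the lattice. *)
Lemma lat_sub g h : h \in unitmx -> lat v g `<=` lat v h <-> intM (invmx h *m g).
Proof.
move=> uh; split=> [sub i j|hi _ [u hu <-]]; last first.
  exists (invmx h *m g *m u); last by rewrite mulmxA mulKVmx.
  by move=> i; apply: intM_mul => // i' j'; rewrite ord1; apply: hu.
have [|w hw e] := sub (g *m delta_mx j 0).
  exists (delta_mx j 0) => // i'; rewrite mxE.
  by case: (_ && _); [right; rewrite (v1 HF)|left].
suff -> : (invmx h *m g) i j = w i 0 by apply: hw.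
have -> : w = invmx h *m (g *m delta_mx j 0) by rewrite -e mulKmx.
by rewrite mulmxA -colE [RHS]mxE.
Qed.

Lemma lat_eq g h : g \in unitmx -> h \in unitmx ->
  lat v g = lat v h <-> GL2O (invmx h *m g).
Proof.
move=> ug uh; have e : invmx (invmx h *m g) = invmx g *m h.
  have u : invmx h *m g \in unitmx by rewrite unitmx_mul unitmx_inv uh.
  apply: (can_inj (mulKmx u)); rewrite mulmxV // -mulmxA (mulmxA g) mulmxV //.
  by rewrite mul1mx mulVmx.
split=> [l|l].
  apply: GL2O_of_int; first by rewrite unitmx_mul unitmx_inv uh.
    by apply/lat_sub => //; rewrite l.
  by rewrite e; apply/lat_sub => //; rewrite l.
apply/seteqP; split; apply/lat_sub => //; first by case: l.
by rewrite -e; case: (GL2O_inv l).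
Qed.

Lemma scale_lat (c : F) g : [set c *: u | u in lat v g] = lat v (c *: g).
Proof.
apply/seteqP; split=> [_ [_ [u hu <-] <-]|_ [u hu <-]].
  by exists u => //; rewrite scalemxAl.
by exists (g *m u); [exists u|rewrite scalemxAl].
Qed.

Definition latclass g : vertex F := hclass (lat v g).
Local Notation V := latclass.

Lemma latclass_lat g : V g (lat v g).
Proof. by exists 1; split; [exact: oner_neq0|rewrite scale_lat scale1r]. Qed.

Lemma latclassZ c g : c != 0 -> V (c *: g) = V g.
Proof.
move=> c0; apply/seteqP; split=> [_ [d [d0 ->]]|_ [d [d0 ->]]].
  by exists (d * c); split; [rewrite mulf_neq0|rewrite !scale_lat scalerA].
exists (d / c); split; first by rewrite mulf_neq0 ?invr_eq0.
by rewrite !scale_lat scalerA divfK.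
Qed.

Lemma unitmxZ2 c g : c != 0 -> (c *: g \in unitmx) = (g \in unitmx).
Proof. by move=> c0; rewrite unitmxZ ?unitfE. Qed.

Lemma latclass_eq g h : g \in unitmx -> h \in unitmx ->
  V g = V h <-> exists2 c, c != 0 & GL2O (c *: (invmx h *m g)).
Proof.
move=> ug uh; split=> [e|[c c0]].
  have : V h (lat v g) by rewrite -e; apply: latclass_lat.
  move=> [c [c0]]; rewrite scale_lat => /lat_eq => /(_ ug).
  rewrite unitmxZ2 // => /(_ uh); rewrite invmxZ ?unitmxZ2 // -scalemxAl => hh.
  by exists c^-1; rewrite ?invr_eq0.
rewrite scalemxAr => /lat_eq; rewrite unitmxZ2 // => /(_ ug uh).
by rewrite -(latclassZ g c0) /latclass => ->.
Qed.

Lemma latclass_mulGL g K : g \in unitmx -> GL2O K -> V (g *m K) = V g.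
Proof.
move=> ug hK; rewrite /latclass; congr hclass; apply/lat_eq => //.
  by rewrite unitmx_mul ug GL2O_unitmx.
by rewrite mulKmx.
Qed.

Lemma act_latclass g h : act g (V h) = V (g *m h).
Proof.
apply/seteqP; split=> [_ [_ [c [c0 ->]] <-]|_ [c [c0 ->]]].
  exists c; split=> //; rewrite !scale_lat.
  apply/seteqP; split=> [_ [_ [u hu <-] <-]|_ [u hu <-]].
    by exists u => //; rewrite -!scalemxAl -scalemxAr mulmxA.
  exists (c *: h *m u); first by exists u.
  by rewrite -!scalemxAl -scalemxAr mulmxA.
exists (lat v (c *: h)); first by exists c; rewrite scale_lat.
rewrite scale_lat scalemxAr.
apply/seteqP; split=> [_ [_ [u hu <-] <-]|_ [u hu <-]].
  by exists u; rewrite ?mulmxA.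
by exists (c *: h *m u); [exists u|rewrite mulmxA].
Qed.

Lemma is_vertexP X : is_vertex v X <-> exists2 g, g \in unitmx & X = V g.
Proof.
split=> [[L [[g [ug ->]] ->]]|[g ug ->]]; first by exists g.
by exists (lat v g); split=> //; exists g.
Qed.

Lemma unitmx_diag (a d : F) : (mx2 a 0 0 d \in unitmx) = (a != 0) && (d != 0).
Proof. by rewrite unitmx2 det_mx2 mulr0 subr0 mulf_eq0 negb_or. Qed.

Lemma GL2O_diag a d : a != 0 -> d != 0 -> v a = 0 -> v d = 0 -> GL2O (mx2 a 0 0 d).
Proof.
move=> a0 d0 va vd; apply: GL2O_mx2; rewrite ?mulr0 ?subr0 ?mulf_neq0 //.
- by right; rewrite va.
- by left.
- by left.
- by right; rewrite vd.
- by rewrite (vM HF) // va vd addr0.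
Qed.

Lemma GL2O_diagP a d : a != 0 -> d != 0 -> GL2O (mx2 a 0 0 d) -> v a = 0 /\ v d = 0.
Proof.
move=> a0 d0 [h _ ]; rewrite det_mx2 mulr0 subr0 (vM HF) // => e.
have := h 0 0; have := h 1 1; rewrite !mx2E.
case=> [/eqP|h1]; first by rewrite (negPf d0).
case=> [/eqP|h2]; first by rewrite (negPf a0).
by lia.
Qed.

Definition mxge N (E : 'M[F]_2) := forall i j, vge v N (E i j).

Lemma mxge_mx2 N E : [/\ vge v N (E 0 0), vge v N (E 0 1), vge v N (E 1 0) & vge v N (E 1 1)] ->
  mxge N E.
Proof. by case=> *; do 2!apply: ord2P. Qed.

Lemma mx_bound (A : 'M[F]_2) : exists a : int, mxge a A.
Proof.
exists (Num.min (Num.min (v (A 0 0)) (v (A 0 1))) (Num.min (v (A 1 0)) (v (A 1 1)))).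
by apply: mxge_mx2; split; right; lia.
Qed.

(** Continuity of two-sided multiplication at 0; it says how closely a matrix must be approximated
    for a conjugated error to stay small. *)
Lemma small_mul (A B : 'M[F]_2) N : exists M, forall E, mxge M E -> mxge N (A *m E *m B).
Proof.
have [[a ha] [b hb]] := (mx_bound A, mx_bound B).
exists (N - a - b) => E hE i j; rewrite mxE; apply: vge_sum => k.
apply: (vgeM_le HF _ (n := N - b)) (hb _ _); first by lia.
rewrite mxE; apply: vge_sum => l.
by apply: (vgeM_le HF _ (ha _ _) (hE _ _)); lia.
Qed.

Hypothesis p_pr : prime p.

(** * The standard apartment *)

Definition diagp (n : int) : 'M[F]_2 := mx2 1 0 0 (p%:R ^ n).
Local Notation D := diagp.

Lemma sig0E n : sig0 p v n = V (D n). Proof. by []. Qed.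

Lemma diagp_unitmx n : D n \in unitmx.
Proof. by rewrite unitmx2 det_mx2 mul1r mulr0 subr0 (piX_neq0 HF p_pr). Qed.

Lemma diagp_add m n : D m *m D n = D (m + n).
Proof.
rewrite mul_mx2 !(mulr0, mul0r, addr0, add0r, mulr1).
by rewrite /diagp expfzDr // (pi_neq0 HF p_pr).
Qed.

Lemma diagp0 : D 0 = 1%:M. Proof. by rewrite scalar_mx2 /diagp expr0z. Qed.

Lemma invmx_diagp n : invmx (D n) = D (- n).
Proof.
apply: (can_inj (mulKmx (diagp_unitmx n))); rewrite mulmxV ?diagp_unitmx //.
by rewrite diagp_add subrr diagp0.
Qed.

(** Up to the homothety [a] the diagonal matrix is [diag(1, d / a)], and [d / a] is a unit times a
    power of [p]. *)
Lemma latclass_diag g a d : g \in unitmx -> a != 0 -> d != 0 ->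
  V (g *m mx2 a 0 0 d) = V (g *m D (v d - v a)).
Proof.
move=> ug a0 d0; set n := v d - v a.
have n0 := piX_neq0 HF p_pr n.
have [da0 dn0] : d / a != 0 /\ d / a / p%:R ^ n != 0.
  by rewrite !mulf_neq0 ?invr_eq0.
rewrite -(latclassZ (g *m D n) a0) -[in RHS](latclass_mulGL _ (K := mx2 1 0 0 (d / a / p%:R ^ n))).
- congr V; rewrite -scalemxAl -mulmxA scalemxAr; congr (_ *m _).
  rewrite mul_mx2 scale_mx2; congr mx2; first by ring.
  + by ring.
  + by ring.
  + by rewrite mul0r add0r; field; rewrite a0 n0.
- by rewrite unitmxZ2 // unitmx_mul ug diagp_unitmx.
- apply: GL2O_diag; rewrite ?oner_neq0 ?(v1 HF) //.
  rewrite !(vM HF) ?(vV HF) ?(v_piX HF p_pr) ?invr_eq0 ?mulf_neq0 ?invr_eq0 //.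
  by rewrite /n; lia.
Qed.

Lemma sig0_inj : injective (sig0 p v).
Proof.
move=> m n; rewrite !sig0E => /latclass_eq; rewrite !diagp_unitmx => /(_ isT isT) [c c0].
have n0 := piX_neq0 HF p_pr (- n + m).
rewrite invmx_diagp diagp_add scale_mx2 !mulr0 => /GL2O_diagP.
rewrite !mulf_neq0 ?oner_neq0 // => /(_ isT isT).
rewrite !(vM HF) ?oner_neq0 // (v1 HF) (v_piX HF p_pr); lia.
Qed.

(** Determinant 1 preserves the types of vertices: a scalar [c] contributes [2 v(c)] to the
    valuation of the determinant, so [n - m] must be even. *)
Lemma latclass_parity g m n : \det g = 1 -> V (g *m D m) = V (D n) ->
  exists k, n - m = k + k.
Proof.
move=> dg; have ug : g \in unitmx by rewrite unitmx2 dg oner_neq0.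
move=> /latclass_eq; rewrite unitmx_mul ug !diagp_unitmx => /(_ isT isT) [c c0] [_ _].
rewrite detZ !det_mulmx dg invmx_diagp !det_mx2 mulr0 !subr0 !mul1r.
have h k := piX_neq0 HF p_pr k.
rewrite expr2 !(vM HF) ?mulf_neq0 // !(v_piX HF p_pr) => e.
by exists (v c); lia.
Qed.

(* The two equations bound the two diagonal entries of [g] respectively. *)
Lemma latclass_swap g m n : \det g = 1 -> V (g *m D m) = V (D n) -> V (g *m D n) = V (D m) ->
  exists2 k, n - m = k + k & vge v k (\tr g).
Proof.
move=> dg; have ug : g \in unitmx by rewrite unitmx2 dg oner_neq0.
have h k := piX_neq0 HF p_pr k.
have H m' n' : V (g *m D m') = V (D n') ->
    exists k, [/\ n' - m' = k + k, vge v (- k) (g 0 0) & vge v k (g 1 1)].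
  move=> /latclass_eq; rewrite unitmx_mul ug !diagp_unitmx => /(_ isT isT) [c c0] [hi _].
  rewrite detZ !det_mulmx dg invmx_diagp !det_mx2 mulr0 !subr0 !mul1r.
  rewrite expr2 !(vM HF) ?mulf_neq0 // !(v_piX HF p_pr) => e.
  have := hi 0 0; have := hi 1 1.
  rewrite invmx_diagp {1 2}(mx2_eta g) !mul_mx2 scale_mx2 !mx2E.
  rewrite !(mulr0, mul0r, mulr1, mul1r, add0r, addr0) => h1 h2.
  exists (v c); split; first by lia.
    rewrite -[g 0 0](mulKf c0); apply: (vgeM_le HF) h2; last first.
      by right; rewrite (vV HF).
    by lia.
  have -> : g 1 1 = (c * p%:R ^ (- n') * p%:R ^ m')^-1 *
      (c * (p%:R ^ (- n') * (g 1 1 * p%:R ^ m'))).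
    by field; rewrite c0 !h.
  apply: (vgeM_le HF) h1; last by right.
  by rewrite (vV HF) ?mulf_neq0 // !(vM HF) ?mulf_neq0 // !(v_piX HF p_pr); lia.
(* The second equation comes with [k' = - k], so its bound [- k'] on the entry [g 0 0] is [k], the
   same as that of the first equation on [g 1 1]. *)
move=> /H [k [e1 _ h1]] /H [k' [e2 h2 _]]; exists k => //.
have kk : - k' = k by lia.
rewrite kk in h2; rewrite (mx2_eta g) trace_mx2; exact: (vgeD HF).
Qed.

End Lattices.

(** * The tree *)

Section Tree.
Variables (p : nat) (F : fieldType) (v : F -> int).
Hypotheses (HF : padic_field p v) (p_pr : prime p).
Implicit Types (g h K M : 'M[F]_2).

Local Notation D := (@diagp p F).
Local Notation V := (latclass v).
Local Notation sig := (sig0 p v).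
Local Notation GL2O := (GL2O v).
Local Notation intM := (intM v).
Local Notation adj := (adjacent p v).

Local Notation W := (mx2 0 1 1 0 : 'M[F]_2).

Lemma mulWW : W *m W = 1%:M.
Proof. by rewrite mul_mx2 scalar_mx2 !(mulr0, mul0r, addr0, add0r, mulr1). Qed.

Lemma unitmxW : W \in unitmx.
Proof. by rewrite unitmx2 det_mx2 mul0r mul1r sub0r oppr_eq0 oner_eq0. Qed.

Lemma GL2O_W : GL2O W.
Proof.
have h0 : vge v 0 0 by left.
have h1 : vge v 0 1 by right; rewrite (v1 HF).
by apply: GL2O_mx2 => //; rewrite mul0r mul1r sub0r ?oppr_eq0 ?oner_eq0 ?(vN HF) ?(v1 HF).
Qed.

(** Elementary divisors over the valuation ring: an entry of least valuation is brought to the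
    corner by permutations and divides all the others, so integral shears clear its row and
    column. *)
Lemma smith M : M \in unitmx -> exists K K' a d,
  [/\ GL2O K, GL2O K', a != 0 /\ d != 0, v a <= v d & M = K *m mx2 a 0 0 d *m K'].
Proof.
move=> uM.
have [i0 [j0 M0]] : exists i j, M i j != 0.
  move: uM; rewrite unitmx2 det_mx2E; have [->|] := eqVneq (M 0 0) 0; last by exists 0, 0.
  rewrite mul0r sub0r oppr_eq0 mulf_eq0 negb_or => /andP[h _]; by exists 0, 1.
have [i [j [m0 mmin]]] : exists i j, M i j != 0 /\
    forall i' j', vge v (v (M i j)) (M i' j').
  case: (@arg_minP _ _ _ (i0, j0) (fun ij => M ij.1 ij.2 != 0)
    (fun ij => v (M ij.1 ij.2))) => //= -[i j] /= h hmin.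
  exists i, j; split=> // i' j'; have [->|h'] := eqVneq (M i' j') 0; first by left.
  by right; apply: (hmin (i', j')).
pose perm (i : 'I_2) : 'M[F]_2 := if i == 0 then 1%:M else W.
have GP k : GL2O (perm k) by rewrite /perm; case: ifP => _; [apply: GL2O_1 HF|apply: GL2O_W].
have PP k : perm k *m perm k = 1%:M.
  by rewrite /perm; case: ifP => _; rewrite ?mulmx1 ?mulWW.
pose N := perm i *m M *m perm j.
have MN : M = perm i *m N *m perm j.
  by rewrite /N !mulmxA PP mul1mx -mulmxA PP mulmx1.
have uN : N \in unitmx.
  by rewrite !unitmx_mul uM !(GL2O_unitmx (GP _)).
have permE k l : (perm k *m M *m perm l) 0 0 = M k l.
  rewrite /perm (mx2_eta M); move: k l.
  by do 2!apply: ord2P; rewrite /= ?mulmx1 ?mul1mx ?mul_mx2 !mx2E //; ring.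
have N00 : N 0 0 = M i j by apply: permE.
have Nmin i' j' : vge v (v (N 0 0)) (N i' j').
  have [[hi _ _] [hj _ _]] := (GP i, GP j).
  rewrite N00 mxE; apply: (vge_sum HF) => k.
  rewrite -[v _]addr0; apply: (vgeM HF); last exact: hj.
  rewrite mxE; apply: (vge_sum HF) => l.
  by rewrite -[v _]add0r; apply: (vgeM HF).
rewrite -{}N00 in m0; rewrite (mx2_eta N) in MN uN.
move: (N 0 0) (N 0 1) (N 1 0) (N 1 1) (Nmin 0 1) (Nmin 1 0) (Nmin 1 1) m0 MN uN.
move=> a b c d hb hc hd a0 MN uN {Nmin N}.
have va0 x : vge v (v a) x -> vge v 0 (x / a).
  by move=> h; rewrite -[0](subrr (v a)); apply: (vgeM HF) h _; right; rewrite (vV HF).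
have h0 : vge v 0 0 by left.
have h1 : vge v 0 1 by right; rewrite (v1 HF).
have e : mx2 a b c d = mx2 1 0 (c / a) 1 *m mx2 a 0 0 (d - b * c / a) *m mx2 1 (b / a) 0 1.
  by rewrite !mul_mx2; congr mx2; field.
have G1 : GL2O (mx2 1 0 (c / a) 1).
  by apply: GL2O_mx2; rewrite ?mul0r ?mulr1 ?subr0 ?oner_neq0 ?(v1 HF) //; apply: va0.
have G2 : GL2O (mx2 1 (b / a) 0 1).
  by apply: GL2O_mx2; rewrite ?mulr0 ?mulr1 ?subr0 ?oner_neq0 ?(v1 HF) //; apply: va0.
exists (perm i *m mx2 1 0 (c / a) 1), (mx2 1 (b / a) 0 1 *m perm j), a, (d - b * c / a).
have d0 : d - b * c / a != 0.
  move: uN; rewrite unitmx2 det_mx2; apply: contra => /eqP h.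
  apply/eqP; have -> : a * d - b * c = a * (d - b * c / a) by field.
  by rewrite h mulr0.
split=> //; [exact: (GL2O_mul HF)|exact: (GL2O_mul HF)| |].
  have : vge v (v a) (d - b * c / a).
    apply: (vgeB HF) => //; rewrite -mulrA -[v a]addr0; apply: (vgeM HF) => //.
    exact: va0.
  by case=> // /eqP; rewrite (negPf d0).
by rewrite MN e !mulmxA.
Qed.

(** With [L = g O^2] and [L' = c h O^2] the four clauses say that [L'] lies in [L], differs from it,
    contains [p L] and differs from that. Only the ratio [c] of the two homotheties matters. *)
Lemma adj_latclass g h : g \in unitmx -> h \in unitmx ->
  adj (V g) (V h) <-> exists2 c, c != 0 &
    [/\ intM (c *: (invmx g *m h)), ~ GL2O (c *: (invmx g *m h)),
        intM ((p%:R / c) *: (invmx h *m g)) & ~ GL2O ((p%:R / c) *: (invmx h *m g))].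
Proof.
have p0 := pi_neq0 HF p_pr.
move=> ug uh; split=> [[_ _ [L [L' [[a [a0 ->]] [b [b0 ->]]]]]]|[c c0 [h1 h2 h3 h4]]].
  rewrite !scale_lat => -[s1 n1] [s2 n2].
  have ua : a *: g \in unitmx by rewrite unitmxZ2.
  have ub : b *: h \in unitmx by rewrite unitmxZ2.
  have upa : p%:R *: (a *: g) \in unitmx by rewrite unitmxZ2.
  exists (b / a); first by rewrite mulf_neq0 ?invr_eq0.
  have e1 : (b / a) *: (invmx g *m h) = invmx (a *: g) *m (b *: h).
    by rewrite invmxZ // -scalemxAl -scalemxAr scalerA mulrC.
  have e2 : (p%:R / (b / a)) *: (invmx h *m g) = invmx (b *: h) *m (p%:R *: (a *: g)).
    rewrite invmxZ // -scalemxAl -!scalemxAr !scalerA; congr (_ *: _); field.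
    by rewrite a0 b0.
  rewrite e1 e2; split; [exact/(lat_sub HF)| |exact/(lat_sub HF)|].
    by move/(lat_eq HF ub ua).
  by move/(lat_eq HF upa ub).
have uc : c *: h \in unitmx by rewrite unitmxZ2.
have up : p%:R *: g \in unitmx by rewrite unitmxZ2.
split; [by apply/is_vertexP; exists g|by apply/is_vertexP; exists h|].
exists (lat v g), (lat v (c *: h)); rewrite scale_lat.
have e1 : c *: (invmx g *m h) = invmx g *m (c *: h) by rewrite scalemxAr.
have e2 : (p%:R / c) *: (invmx h *m g) = invmx (c *: h) *m (p%:R *: g).
  by rewrite invmxZ // -scalemxAl -!scalemxAr !scalerA mulrC.
rewrite e1 in h1 h2; rewrite e2 in h3 h4.
split; [exact: latclass_lat|by exists c; rewrite scale_lat| |].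
  by split; [exact/(lat_sub HF)|move/(lat_eq HF uc ug)].
by split; [exact/(lat_sub HF)|move/(lat_eq HF up uc)].
Qed.

Lemma adj_edge h : h \in unitmx -> adj (V h) (V (h *m D 1)).
Proof.
have p0 := pi_neq0 HF p_pr.
have h0 : vge v 0 0 by left.
have h1 : vge v 0 1 by right; rewrite (v1 HF).
have hp : vge v 0 p%:R by right; rewrite (v_pi HF p_pr).
move=> uh; have uD := diagp_unitmx HF p_pr 1.
apply/adj_latclass => //; first by rewrite unitmx_mul uh.
have e1 : invmx h *m (h *m D 1) = D 1 by rewrite mulKmx.
have e2 : invmx (h *m D 1) *m h = D (- 1).
  apply: (can_inj (mulKmx (_ : h *m D 1 \in unitmx))); first by rewrite unitmx_mul uh.
  rewrite mulKVmx ?unitmx_mul ?uh //.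
  by rewrite -mulmxA (diagp_add HF p_pr) subrr diagp0 mulmx1.
exists 1; first exact: oner_neq0.
rewrite e1 e2 scale1r divr1 scale_mx2 mulr1 mulr0 /diagp exprN1 divff // expr1z.
have np : v p%:R <> 0 by rewrite (v_pi HF p_pr).
by split; [exact: intM_mx2|move/(GL2O_diagP HF); rewrite oner_neq0 => /(_ isT p0) []|
  exact: intM_mx2|move/(GL2O_diagP HF); rewrite oner_neq0 => /(_ p0 isT) []].
Qed.

(** By [smith] the relative position of the two lattices is [diag(a, d)] with
    [0 <= v a <= v d <= 1]. The two strictness clauses exclude equality, which leaves [v a = 0] and
    [v d = 1]. *)
Lemma adjP X Y : adj X Y <-> exists h, [/\ h \in unitmx, X = V h & Y = V (h *m D 1)].
Proof.
split=> [|[h [uh -> ->]]]; last exact: adj_edge.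
have p0 := pi_neq0 HF p_pr.
move=> XY; have [/is_vertexP[g ug eX] /is_vertexP[h uh eY] _] := XY.
move: XY; rewrite {}eX {}eY => /(adj_latclass ug uh) [c c0].
have uM : c *: (invmx g *m h) \in unitmx by rewrite unitmxZ2 // unitmx_mul unitmx_inv ug.
have -> : (p%:R / c) *: (invmx h *m g) = p%:R *: invmx (c *: (invmx g *m h)).
  rewrite invmxZ // scalerA; congr (_ *: _).
  have u : invmx g *m h \in unitmx by rewrite unitmx_mul unitmx_inv ug.
  apply: (can_inj (mulKmx u)); rewrite mulmxV // -mulmxA (mulmxA h) mulmxV //.
  by rewrite mul1mx mulVmx.
have -> : V h = V (g *m (c *: (invmx g *m h))).
  by rewrite -scalemxAr mulKVmx // latclassZ.
move: (c *: _) uM => M uM {c c0 h uh}.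
have [K [K' [a [d [GK GK' [a0 d0] ad]]]]] := smith uM => ->.
have [uK uK'] := (GL2O_unitmx GK, GL2O_unitmx GK').
have uad : mx2 a 0 0 d \in unitmx by rewrite unitmx_diag a0.
have inv : invmx (K *m mx2 a 0 0 d *m K') = invmx K' *m mx2 a^-1 0 0 d^-1 *m invmx K.
  have u : K *m mx2 a 0 0 d *m K' \in unitmx by rewrite !unitmx_mul uK uad.
  apply: (can_inj (mulKmx u)); rewrite mulmxV // -!mulmxA (mulmxA K') mulmxV // mul1mx.
  rewrite (mulmxA (mx2 a 0 0 d)) mul_mx2 !(mulr0, mul0r, addr0, add0r) !divff //.
  by rewrite -scalar_mx2 mul1mx mulmxV.
rewrite inv scalemxAl scalemxAr scale_mx2 !mulr0 => -[h1 h2 h3 h4].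
have i1 : intM (mx2 a 0 0 d).
  have -> : mx2 a 0 0 d = invmx K *m (K *m mx2 a 0 0 d *m K') *m invmx K'.
    by rewrite -!mulmxA mulmxV // mulmx1 mulKmx.
  have [[i _ _] [i' _ _]] := (GL2O_inv HF GK, GL2O_inv HF GK').
  by apply: (intM_mul HF) => //; apply: (intM_mul HF).
have i2 : intM (mx2 (p%:R / a) 0 0 (p%:R / d)).
  set N := mx2 _ _ _ _ in h3 *.
  have -> : N = K' *m (invmx K' *m N *m invmx K) *m K.
    by rewrite -!mulmxA mulVmx // mulmx1 mulKVmx.
  have [[i _ _] [i' _ _]] := (GK, GK').
  by apply: (intM_mul HF) => //; apply: (intM_mul HF).
have va : 0 <= v a by case: (i1 0 0); rewrite mx2E // => /eqP; rewrite (negPf a0).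
have vd : v d <= 1.
  case: (i2 1 1); rewrite mx2E; first by move/eqP; rewrite mulf_eq0 invr_eq0 (negPf p0) (negPf d0).
  by rewrite (vM HF) ?invr_eq0 // (vV HF) // (v_pi HF p_pr); lia.
have n1 : ~ (v a = 0 /\ v d = 0).
  case=> e1 e2; apply: h2; apply: (GL2O_mul HF) => //; apply: (GL2O_mul HF) => //.
  exact: (GL2O_diag HF).
have n2 : ~ (v a = 1 /\ v d = 1).
  case=> e1 e2; apply: h4; apply: (GL2O_mul HF); last exact: (GL2O_inv HF).
  apply: (GL2O_mul HF); first exact: (GL2O_inv HF).
  by apply: (GL2O_diag HF); rewrite ?mulf_neq0 ?invr_eq0 // (vM HF) ?invr_eq0 // (vV HF) //
    (v_pi HF p_pr) ?e1 ?e2.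
exists (g *m K); split; first by rewrite unitmx_mul ug.
  by rewrite (latclass_mulGL HF).
rewrite !mulmxA (latclass_mulGL HF (K := K')) ?unitmx_mul ?ug ?uK //
  (latclass_diag HF p_pr) ?unitmx_mul ?ug //.
by have -> : v d - v a = 1 by lia.
Qed.

Lemma act_mul g h X : act g (act h X) = act (g *m h) X.
Proof.
rewrite /act image_comp; apply: eq_imagel => L _ /=; rewrite image_comp.
by apply: eq_imagel => u _ /=; rewrite mulmxA.
Qed.

Lemma act1 (X : vertex F) : act 1%:M X = X.
Proof.
apply: eq_image_id => L _; apply: eq_image_id => u _; exact: mul1mx.
Qed.

Lemma actK g X : g \in unitmx -> act (invmx g) (act g X) = X.
Proof. by move=> ug; rewrite act_mul mulVmx // act1. Qed.

Lemma actKV g X : g \in unitmx -> act g (act (invmx g) X) = X.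
Proof. by move=> ug; rewrite act_mul mulmxV // act1. Qed.

Lemma act_sig g n : act g (sig n) = V (g *m D n).
Proof. by rewrite sig0E act_latclass. Qed.

Lemma act_adj g X Y : g \in unitmx -> adj X Y -> adj (act g X) (act g Y).
Proof.
move=> ug /adjP[h [uh -> ->]]; rewrite !act_latclass mulmxA; apply: adj_edge.
by rewrite unitmx_mul ug.
Qed.

Lemma act_W n : act W (sig n) = sig (- n).
Proof.
rewrite act_sig sig0E -[in RHS](mul1mx (D (- n))).
have n0 := piX_neq0 HF p_pr n.
rewrite -(latclass_mulGL HF (g := W *m D n) (K := W))
  ?unitmx_mul ?unitmxW ?(diagp_unitmx HF p_pr) //; last exact: GL2O_W.
rewrite !mul_mx2 !(mulr0, mul0r, mulr1, mul1r, add0r, addr0).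
rewrite -[mx2 _ 0 0 1]mul1mx (latclass_diag HF p_pr) ?unitmx1 ?oner_neq0 //.
by rewrite (v1 HF) (v_piX HF p_pr) sub0r.
Qed.

End Tree.

(** * Apartments *)

Section Apartments.
Variables (p : nat) (F : fieldType) (v : F -> int).
Hypotheses (HF : padic_field p v) (p_pr : prime p).
Implicit Types (g h K M : 'M[F]_2).

Local Notation D := (@diagp p F).
Local Notation V := (latclass v).
Local Notation sig := (sig0 p v).
Local Notation GL2O := (GL2O v).
Local Notation intM := (intM v).
Local Notation adj := (adjacent p v).
Local Notation W := (mx2 0 1 1 0 : 'M[F]_2).

(** The numbers [v c] and [v c + n - m] both lie in {0, 1}, and they are neither both 0 nor both
    1. *)
Lemma adj_sig m n : adj (sig m) (sig n) -> n = m + 1 \/ n = m - 1.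
Proof.
have p0 := pi_neq0 HF p_pr.
have pk0 k := piX_neq0 HF p_pr k.
rewrite !sig0E => /(adj_latclass HF p_pr); rewrite !(diagp_unitmx HF p_pr) => /(_ isT isT) [c c0].
rewrite !(invmx_diagp HF p_pr) !(diagp_add HF p_pr) !scale_mx2 !mulr0 !mulr1 => -[h1 h2 h3 h4].
have g0 a k : a != 0 -> intM (mx2 a 0 0 (a * p%:R ^ k)) -> 0 <= v a /\ 0 <= v a + k.
  move=> a0 h; split.
    by have := h 0 0; rewrite mx2E => -[/eqP|//]; rewrite (negPf a0).
  have := h 1 1; rewrite mx2E => -[/eqP|]; first by rewrite mulf_eq0 (negPf a0) (negPf (pk0 _)).
  by rewrite (vM HF) // (v_piX HF p_pr).
have g1 a k : a != 0 -> ~ GL2O (mx2 a 0 0 (a * p%:R ^ k)) -> ~ (v a = 0 /\ v a + k = 0).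
  move=> a0 h [e1 e2]; apply: h; apply: (GL2O_diag HF); rewrite ?mulf_neq0 //.
  by rewrite (vM HF) // (v_piX HF p_pr).
have pc0 : p%:R / c != 0 :> F by rewrite mulf_neq0 ?invr_eq0.
have := g0 _ _ c0 h1; have := g1 _ _ c0 h2.
have := g0 _ _ pc0 h3; have := g1 _ _ pc0 h4.
rewrite (vM HF) ?invr_eq0 // (vV HF) // (v_pi HF p_pr).
move: (v c) => k; clear; lia.
Qed.

(** Conjugation by [D i] turns [y] into [p^(-i) y], which remains integral for [i <= n]. Such shears
    fix a ray pointwise and are used to bend the rest of Sigma_0. *)
Lemma lower_fixes n i (y : F) : vge v n y -> i <= n -> act (mx2 1 0 y 1) (sig i) = sig i.
Proof.
move=> hy ni; have i0 := piX_neq0 HF p_pr i.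
rewrite act_sig sig0E.
have -> : mx2 1 0 y 1 *m D i = D i *m mx2 1 0 (p%:R ^ (- i) * y) 1.
  rewrite !mul_mx2 !(mulr0, mul0r, mulr1, mul1r, add0r, addr0).
  by rewrite mulrA -expfzDr ?subrr ?expr0z ?mul1r // (pi_neq0 HF p_pr).
apply: (latclass_mulGL HF); first exact: (diagp_unitmx HF p_pr).
have h1 : vge v 0 1 by right; rewrite (v1 HF).
apply: (GL2O_mx2 (v := v)); rewrite ?mul0r ?mulr1 ?subr0 ?oner_neq0 ?(v1 HF) //; first by left.
apply: (vgeM_le HF _ (n := - i)) hy; first by lia.
by right; rewrite (v_piX HF p_pr).
Qed.

Lemma lower_unitmx (y : F) : mx2 1 0 y 1 \in unitmx.
Proof. by rewrite unitmx2 det_mx2 mulr1 mul0r subr0 oner_eq0. Qed.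

(** In the frame of [sig n], a neighbour is determined by the first column [(a, c)] modulo [p] of
    some matrix in GL_2(O), that is, by a point of the projective line over the residue field. If
    [a] is a unit, the shear with entry [c / a] carries [sig (n + 1)] to it; if [p] divides [a], it
    is [sig (n - 1)]. *)
Lemma neighbor_right n Y : adj (sig n) Y -> Y = sig (n - 1) \/
  exists u, [/\ u \in unitmx, (forall i, i <= n -> act u (sig i) = sig i) &
                Y = act u (sig (n + 1))].
Proof.
have p0 := pi_neq0 HF p_pr.
have Un := diagp_unitmx HF p_pr n.
move=> /(act_adj HF p_pr (_ : D (- n) \in unitmx)); rewrite (diagp_unitmx HF p_pr) => /(_ isT).
rewrite act_sig (diagp_add HF p_pr) addNr diagp0 => /(adjP HF p_pr)[h [uh e1 eY]].
have {}eY : Y = V (D n *m h *m D 1).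
  rewrite -mulmxA -act_latclass -eY act_mul (diagp_add HF p_pr) subrr diagp0 act1 //.
move: e1 => /esym /(latclass_eq HF uh (unitmx1 _ _)) [c c0]; rewrite invmx1 mul1mx => G.
have {}eY : Y = V (D n *m (c *: h) *m D 1).
  by rewrite eY -scalemxAr -scalemxAl latclassZ.
move: (c *: h) G eY => K {c c0 h uh} G ->.
have K0 := vge_v v (K 0 0).
have := mx2_eta K.
move: (K 0 0) (K 0 1) (K 1 0) (K 1 1) (G) => a b c d [hi].
move=> _ _ eK; move: G; rewrite eK => G.
have [ha hb hc hd] : [/\ vge v 0 a, vge v 0 b, vge v 0 c & vge v 0 d].
  case: G => [h _ _]; have := (h 0 0, h 0 1, h 1 0, h 1 1); rewrite !mx2E.
  by case=> -[[? ?] ?] ?.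
have [_ d0] := G; rewrite det_mx2 in d0 * => vd0.
have h1 : vge v 0 1 by right; rewrite (v1 HF).
have [[a0 va]|hpa] : (a != 0 /\ v a = 0) \/ vge v 1 a.
  case: (ha) => [->|va]; first by right; left.
  have [->|a0] := eqVneq a 0; first by right; left.
  have [|va'] := eqVneq (v a) 0; first by left.
  by right; right; lia.
- right; exists (mx2 1 0 (p%:R ^ n * (c / a)) 1).
  have hca : vge v 0 (c / a).
    by rewrite -[0]addr0; apply: (vgeM HF) => //; right; rewrite (vV HF) // va.
  split; first exact: lower_unitmx.
    move=> i; apply: lower_fixes; rewrite -[n]addr0; apply: (vgeM HF) => //.
    by right; rewrite (v_piX HF p_pr) addr0.
  rewrite act_sig.
  have G' : GL2O (mx2 a (b * p%:R) 0 ((a * d - b * c) / a)).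
    apply: (GL2O_mx2 (v := v)) => //.
    + rewrite -[0]addr0; apply: (vgeM HF) => //.
      by right; rewrite (v_pi HF p_pr).
    + by left.
    + by right; rewrite (vM HF) ?invr_eq0 // (vV HF) // va vd0.
    + by rewrite mulr0 subr0 mulrC divfK.
    + by rewrite mulr0 subr0 mulrC divfK.
  rewrite -[in RHS](latclass_mulGL HF
      (K := mx2 a (b * p%:R) 0 ((a * d - b * c) / a)) (g := _ *m D _)) //;
    last by rewrite unitmx_mul lower_unitmx (diagp_unitmx HF p_pr).
  congr V; rewrite !mul_mx2 expr1z expfzDr // expr1z.
  rewrite !(mulr0, mul0r, mulr1, mul1r, add0r, addr0).
  by congr mx2; field.
left; rewrite -mulmxA.
have pV : vge v (-1) p%:R^-1 by right; rewrite (vV HF) // (v_pi HF p_pr).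
have G' : GL2O (mx2 (a / p%:R) b c (d * p%:R)).
  have e : a / p%:R * (d * p%:R) - b * c = a * d - b * c by field.
  apply: (GL2O_mx2 (v := v)); rewrite ?e //.
    by apply: (vgeM_le HF) hpa pV; lia.
  by rewrite -[0]addr0; apply: (vgeM HF) => //; right; rewrite (v_pi HF p_pr).
have -> : mx2 a b c d *m D 1 = mx2 p%:R 0 0 1 *m mx2 (a / p%:R) b c (d * p%:R).
  by rewrite !mul_mx2 expr1z !(mulr0, mul0r, mulr1, mul1r, add0r, addr0); congr mx2; field.
have up : (mx2 p%:R 0 0 1 : 'M[F]_2) \in unitmx by rewrite unitmx_diag p0 oner_neq0.
rewrite mulmxA (latclass_mulGL HF) ?unitmx_mul ?Un // (latclass_diag HF p_pr) ?oner_neq0 //.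
by rewrite (diagp_add HF p_pr) sig0E (v1 HF) (v_pi HF p_pr) sub0r.
Qed.

(** The mirror image of [neighbor_right] under [W], which reverses Sigma_0. *)
Lemma neighbor_left n Y : adj (sig n) Y -> Y = sig (n + 1) \/
  exists u, [/\ u \in unitmx, (forall i, n <= i -> act u (sig i) = sig i) &
                Y = act u (sig (n - 1))].
Proof.
have uW := unitmxW F.
move=> /(act_adj HF p_pr uW); rewrite (act_W HF p_pr) => /neighbor_right [e|[u [uu hu e]]].
  left; rewrite -[Y]act1 -mulWW -act_mul e (act_W HF p_pr); congr (sig _); lia.
right; exists (W *m u *m W); split; first by rewrite !unitmx_mul uu uW.
  move=> i ni; rewrite -!act_mul (act_W HF p_pr) hu; last by lia.
  by rewrite (act_W HF p_pr) opprK.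
rewrite -[Y]act1 -mulWW -act_mul e -!act_mul (act_W HF p_pr).
by congr (act _ (act _ (sig _))); lia.
Qed.

(** The segment is straightened edge by edge: injectivity of [f] forbids turning back, and any other
    next vertex is reached by a shear that fixes what is already placed. *)
Lemma line_path (f : int -> vertex F) : line p v f ->
  forall (N : nat) (a : int), exists2 h, h \in unitmx &
    forall i : nat, (i <= N)%N -> f (a + i%:Z) = act h (sig i%:Z).
Proof.
move=> [finj fadj] N a.
(* Segments of length at least one let the induction start from an edge. *)
suff [h uh H] : exists2 h, h \in unitmx &
    forall i : nat, (i <= N.+1)%N -> f (a + i%:Z) = act h (sig i%:Z).
  by exists h => // i iN; apply: H; apply: leqW.
elim: N => [|N [h uh H]].
  have /(adjP HF p_pr)[h [uh e0 e1]] := fadj a.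
  exists h => // -[|[|//]] _; first by rewrite addr0 e0 act_sig diagp0 mulmx1.
  by rewrite e1 act_sig.
have := fadj (a + N.+1%:Z); rewrite H // => /(act_adj HF p_pr (_ : invmx h \in unitmx)).
rewrite unitmx_inv uh => /(_ isT); rewrite actK // => /neighbor_right [e|[u [uu hu e]]].
  have e' : f (a + N.+1%:Z + 1) = f (a + N%:Z).
    rewrite H // -[LHS](actKV _ uh) e; congr (act _ (sig _)); lia.
  by move/finj: e'; lia.
exists (h *m u) => [|i]; first by rewrite unitmx_mul uh.
rewrite -act_mul leq_eqVlt => /orP[/eqP ->|iN].
  have -> : a + N.+2%:Z = a + N.+1%:Z + 1 by lia.
  rewrite -[LHS](actKV _ uh) e; congr (act _ (act _ (sig _))); lia.
by rewrite hu ?H //; lia.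
Qed.

(** A line has no chords, since the segment between the two vertices can be moved into Sigma_0,
    where [adj_sig] applies. *)
Lemma adj_line (f : int -> vertex F) m n : line p v f -> adj (f m) (f n) ->
  n = m + 1 \/ n = m - 1.
Proof.
move=> Lf; have := line_path Lf `|m - n|%N (Num.min m n).
move=> [h uh H] A.
have e k : k \in [:: m; n] -> f k = act h (sig (k - Num.min m n)).
  move=> kk; have := H (absz (k - Num.min m n)).
  have -> : (absz (k - Num.min m n))%:Z = k - Num.min m n by move: kk; rewrite !inE; lia.
  rewrite (addrC (Num.min m n)) subrK; apply.
  by move: kk; rewrite !inE; lia.
move: A; rewrite !e ?inE ?eqxx ?orbT // => /(act_adj HF p_pr (_ : invmx h \in unitmx)).
rewrite unitmx_inv uh => /(_ isT); rewrite !actK // => /adj_sig; lia.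
Qed.

(** The index of [f' n] along [f] moves by steps of 1 or -1 by [adj_line] and cannot turn back by
    injectivity, so it is affine in [n]. *)
Lemma line_range (f f' : int -> vertex F) : line p v f -> line p v f' ->
  range f' `<=` range f ->
  exists c, (forall n, f' n = f (c + n)) \/ (forall n, f' n = f (c - n)).
Proof.
move=> Lf [inj' adj'] sub.
have /choice[s hs] : forall n, exists m, f' n = f m.
  by move=> n; have [//|m _ <-] := sub (f' n); exists m.
have sinj : injective s by move=> m n e; apply: inj'; rewrite !hs e.
have st (n : int) : s (n + 1) = s n + 1 \/ s (n + 1) = s n - 1.
  by apply: (adj_line Lf); rewrite -!hs.
have st2 (n : int) : s (n + 1) - s n = s 1 - s 0.
  have one (k : int) : s (k + 1 + 1) - s (k + 1) = s (k + 1) - s k.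
    have ne : s (k + 1 + 1) <> s k by move/sinj; lia.
    by have := st k; have := st (k + 1); lia.
  elim/int_ind: n => [|k IH|k IH]; first by rewrite add0r.
    have := one k; have -> : k.+1%:Z = k%:Z + 1 by lia.
    by move=> ->.
  have := one (- k.+1%:Z); have -> : - k.+1%:Z + 1 = - k%:Z by lia.
  by move=> <-.
have lin (n : int) : s n = s 0 + (s 1 - s 0) * n.
  elim/int_ind: n => [|k IH|k IH]; first by rewrite mulr0 addr0.
    have := st2 k; have -> : k.+1%:Z = k%:Z + 1 by lia.
    by move=> e; rewrite mulrDr; lia.
  have := st2 (- k.+1%:Z); have -> : - k.+1%:Z + 1 = - k%:Z by lia.
  have -> : - k.+1%:Z = - k%:Z - 1 by lia.
  by move=> e; rewrite mulrBr; lia.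
exists (s 0); have := st 0; rewrite add0r => -[e|e]; [left|right] => n;
  rewrite hs lin e; congr f; lia.
Qed.

Lemma line_sig : line p v sig.
Proof.
split; first exact: (sig0_inj HF p_pr).
move=> n; apply/(adjP HF p_pr); exists (D n); split=> //.
  exact: (diagp_unitmx HF p_pr).
by rewrite (diagp_add HF p_pr).
Qed.

Lemma act_inj g : g \in unitmx -> injective (act g).
Proof. by move=> ug X Y e; rewrite -[X](actK _ ug) e actK. Qed.

Lemma line_act g f : g \in unitmx -> line p v f -> line p v (fun n => act g (f n)).
Proof.
move=> ug [fi fa]; split; first by move=> m n /(act_inj ug) /fi.
by move=> n; apply: (act_adj HF p_pr).
Qed.

(** [apt_edge] quantifies over all parametrisations of the apartment; by [line_range] one of them
    suffices. *)
Lemma apt_edgeP f C : line p v f ->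
  apt_edge p v (range f) C <-> exists m : int, C = [set f m] `|` [set f (m + 1)].
Proof.
move=> Lf; split=> [[f' [Lf' e [n ->]]]|[m ->]]; last by exists f; split=> //; exists m.
have [|c [H|H]] := line_range Lf Lf'; first by rewrite e.
  by exists (c + n); rewrite !H addrA.
exists (c - n - 1); rewrite !H setUC; congr ([set f _] `|` [set f _]); lia.
Qed.

Lemma act_diag (a d : F) n : a != 0 -> d != 0 ->
  act (mx2 a 0 0 d) (sig n) = sig (n + (v d - v a)).
Proof.
move=> a0 d0; have n0 := piX_neq0 HF p_pr n; rewrite act_sig mul_mx2.
rewrite !(mulr0, mul0r, mulr1, mul1r, add0r, addr0).
rewrite -[mx2 a 0 0 _]mul1mx (latclass_diag HF p_pr) ?unitmx1 ?mulf_neq0 // mul1mx sig0E.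
by rewrite (vM HF) // (v_piX HF p_pr); congr (V (D _)); lia.
Qed.

Lemma two_vertices X X' : is_vertex v X -> is_vertex v X' ->
  exists h (k : int), [/\ h \in unitmx, 0 <= k, X = act h (sig 0) & X' = act h (sig k)].
Proof.
move=> /is_vertexP[g ug ->] /is_vertexP[g' ug' ->].
have uM : invmx g *m g' \in unitmx by rewrite unitmx_mul unitmx_inv ug.
have [K [K' [a [d [GK GK' [a0 d0] ad e]]]]] := smith HF uM.
have uK := GL2O_unitmx GK.
exists (g *m K), (v d - v a); split; first by rewrite unitmx_mul ug.
- by lia.
- by rewrite act_sig diagp0 mulmx1 (latclass_mulGL HF).
rewrite act_sig -(latclass_diag HF p_pr) ?unitmx_mul ?ug //.
rewrite -[RHS](latclass_mulGL HF _ GK'); last by rewrite !unitmx_mul ug uK unitmx_diag a0.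
by rewrite -[g'](mulKVmx ug) e !mulmxA.
Qed.

Definition on_edge (h : 'M[F]_2) X Y (a : int) :=
  X = act h (sig a) /\ (Y = act h (sig (a + 1)) \/ Y = act h (sig (a - 1))).

(** [two_vertices] puts [X] and [X'] on Sigma_0; then [Y'] and [Y] are brought there by shears that
    fix the part already placed. *)
Lemma two_chambers_GL2 X Y X' Y' : adj X Y -> adj X' Y' ->
  exists h a b, [/\ h \in unitmx, on_edge h X Y a & on_edge h X' Y' b].
Proof.
move=> XY XY'; have [vX _ _] := XY; have [vX' _ _] := XY'.
have [h [k [uh k0 eX eX']]] := two_vertices vX vX'.
have pull Z n h' Z' : h' \in unitmx -> Z = act h' (sig n) -> adj Z Z' ->
    adj (sig n) (act (invmx h') Z').
  move=> uh' -> /(act_adj HF p_pr (_ : invmx h' \in unitmx)).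
  by rewrite unitmx_inv uh' actK // => /(_ isT).
have push h' Z' T : h' \in unitmx -> act (invmx h') Z' = T -> Z' = act h' T.
  by move=> uh' <-; rewrite actKV.
have := pull _ _ _ _ uh eX' XY'.
(* The shears that fix a ray and move [Y] to the left must also fix [Y']: for
   [k = 0] this depends on the side of [X] on which [Y'] lies. *)
have [{}k0|k0'] : k = 0 \/ 1 <= k by lia.
  rewrite {}k0 in eX' *.
  move=> /(neighbor_right)[/(push _ _ _ uh) eY'|[u [uu hu /(push _ _ _ uh) eY']]].
    have /(neighbor_right)[/(push _ _ _ uh) eY|[u [uu hu /(push _ _ _ uh) eY]]] :=
      pull _ _ _ _ uh eX XY.
      by exists h, 0, 0; split=> //; split=> //; right.
    exists (h *m u), 0, 0; split; first by rewrite unitmx_mul uh.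
      by split; [rewrite -act_mul hu|left; rewrite -act_mul].
    by split; [rewrite -act_mul hu|right; rewrite -act_mul hu].
  have uhu : h *m u \in unitmx by rewrite unitmx_mul uh.
  have {}eX : X = act (h *m u) (sig 0) by rewrite -act_mul hu.
  have {}eX' : X' = act (h *m u) (sig 0) by rewrite -act_mul hu.
  rewrite act_mul in eY'; move: (h *m u) uhu eX eX' eY' => h' uh' {}eX {}eX' {}eY'.
  have /(neighbor_left)[/(push _ _ _ uh') eY|[u' [uu' hu' /(push _ _ _ uh') eY]]] :=
      pull _ _ _ _ uh' eX XY.
    by exists h', 0, 0; split=> //; split=> //; left.
  exists (h' *m u'), 0, 0; split; first by rewrite unitmx_mul uh'.
    by split; [rewrite -act_mul hu'|right; rewrite -act_mul].
  by split; [rewrite -act_mul hu'|left; rewrite -act_mul hu'].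
move=> H; have {h uh eX eX' H} [h [uh eX eX' eY']] : exists h, [/\ h \in unitmx,
    X = act h (sig 0), X' = act h (sig k) &
    Y' = act h (sig (k + 1)) \/ Y' = act h (sig (k - 1))].
  case: (neighbor_right H) => [/(push _ _ _ uh) eY'|[u [uu hu /(push _ _ _ uh) eY']]].
    by exists h; split=> //; right.
  exists (h *m u); rewrite -!act_mul (hu k) // (hu 0) //.
  by split=> //; [rewrite unitmx_mul uh|left].
have /(neighbor_left)[/(push _ _ _ uh) eY|[u [uu hu /(push _ _ _ uh) eY]]] :=
    pull _ _ _ _ uh eX XY.
  by exists h, 0, k; split=> //; split=> //; left.
exists (h *m u), 0, k; split; first by rewrite unitmx_mul uh.
  by split; [rewrite -act_mul hu|right; rewrite -act_mul].
split; first by rewrite -act_mul hu //; lia.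
by case: eY' => ->; [left|right]; rewrite -act_mul hu //; lia.
Qed.

(** The determinant is corrected by [diag(1, (det h)^-1)], which only translates Sigma_0 and so
    shifts the indices. *)
Lemma two_chambers X Y X' Y' : adj X Y -> adj X' Y' ->
  exists h a b, [/\ \det h = 1, on_edge h X Y a & on_edge h X' Y' b].
Proof.
move=> XY XY'; have [h [a [b [uh ea eb]]]] := two_chambers_GL2 XY XY'.
have d0 : \det h != 0 by rewrite -unitmx2.
pose h' := h *m mx2 1 0 0 (\det h)^-1; pose m := v (\det h).
have hE n : act h (sig n) = act h' (sig (n + m)).
  rewrite -act_mul act_diag ?oner_neq0 ?invr_eq0 // (vV HF) // (v1 HF).
  by congr (act h (sig _)); rewrite -/m; lia.
have on Z T n : on_edge h Z T n -> on_edge h' Z T (n + m).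
  rewrite /on_edge !hE; have -> : n + 1 + m = n + m + 1 by lia.
  by have -> : n - 1 + m = n + m - 1 by lia.
exists h', (a + m), (b + m); split; [|exact: on|exact: on].
by rewrite det_mulmx det_mx2 mulr0 subr0 mul1r mulfV.
Qed.

(** Conjugation by [D m] multiplies the off-diagonal entries by [p^m] and [p^(-m)], which keeps them
    integral when [|m| <= N]; the determinant is a unit because it is 1 modulo [p]. *)
Lemma congr_fixes N n E : 1 <= N -> - N <= n <= N -> mxge v N E ->
  1%:M + E \in unitmx /\ act (1%:M + E) (sig n) = sig n.
Proof.
move=> N1 /andP[n1 n2] hE.
have gen m : - N <= m <= N -> GL2O (D (- m) *m ((1%:M + E) *m D m)).
  move=> /andP[m1 m2]; have h k := piX_neq0 HF p_pr k.
  rewrite (mx2_eta E) scalar_mx2 add_mx2 !mul_mx2.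
  rewrite !(mulr0, mul0r, mulr1, mul1r, add0r, addr0).
  have one : vge v 0 1 by right; rewrite (v1 HF).
  have hp k : vge v k (p%:R ^ k) by right; rewrite (v_piX HF p_pr).
  set y := E 0 0 + E 1 1 + E 0 0 * E 1 1 - E 0 1 * E 1 0.
  have hy : vge v 1 y.
    apply: (vgeB HF); first apply: (vgeD HF); first apply: (vgeD HF).
    - exact: vge_le (hE _ _).
    - exact: vge_le (hE _ _).
    - by apply: (vgeM_le HF _ (hE _ _) (hE _ _)); lia.
    - by apply: (vgeM_le HF _ (hE _ _) (hE _ _)); lia.
  have [d0 vd] : 1 + y != 0 /\ v (1 + y) = 0.
    rewrite -(v1 HF); apply: (v_dominant HF); first exact: oner_neq0.
    by rewrite (v1 HF) add0r.
  have de : (1 + E 0 0) * (p%:R ^ (- m) * ((1 + E 1 1) * p%:R ^ m)) -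
      E 0 1 * p%:R ^ m * (p%:R ^ (- m) * E 1 0) = 1 + y.
    have e : p%:R ^ (- m) * p%:R ^ m = 1 :> F.
      by rewrite -expfzDr ?addNr ?expr0z // (pi_neq0 HF p_pr).
    have -> : (1 + E 0 0) * (p%:R ^ (- m) * ((1 + E 1 1) * p%:R ^ m)) -
      E 0 1 * p%:R ^ m * (p%:R ^ (- m) * E 1 0) =
      ((1 + E 0 0) * (1 + E 1 1) - E 0 1 * E 1 0) * (p%:R ^ (- m) * p%:R ^ m) by ring.
    by rewrite e /y; ring.
  have i1 i : vge v 0 (1 + E i i).
    by apply: (vgeD HF) => //; apply: vge_le (hE _ _); lia.
  apply: (GL2O_mx2 (v := v)); rewrite ?de //.
  - by apply: (vgeM_le HF _ (hE _ _) (hp _)); lia.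
  - by apply: (vgeM_le HF _ (hp _) (hE _ _)); lia.
  - apply: (vgeM_le HF _ (hp _)); last by apply: (vgeM HF) (hp _).
    by lia.
have u : 1%:M + E \in unitmx.
  have /GL2O_unitmx : GL2O (D (- 0) *m ((1%:M + E) *m D 0)) by apply: gen; lia.
  by rewrite !unitmx_mul => /andP[_ /andP[]].
split=> //; rewrite act_sig sig0E; apply/(latclass_eq HF);
  rewrite ?unitmx_mul ?u ?(diagp_unitmx HF p_pr) //.
exists 1; rewrite ?oner_neq0 // scale1r (invmx_diagp HF p_pr); apply: gen; lia.
Qed.

End Apartments.

(** * The norm-one group *)

Section Quaternions.
Variables (p : nat) (F : fieldType) (v : F -> int) (alpha beta : rat) (s : F).
Hypotheses (HF : padic_field p v) (p_pr : prime p).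
Hypothesis (hs : s ^+ 2 = ratr alpha).

Local Notation sig := (sig0 p v).
Local Notation rho := (rho beta s).
Local Notation N := (qnorm alpha beta).
Local Notation G := (normone alpha beta).
Local Notation qmul := (qmul alpha beta).
Local Notation D := (@diagp p F).
Local Notation V := (latclass v).

Definition qconj (x : quat) := Quat (x1 x) (- x2 x) (- x3 x) (- x4 x).
Definition qscale (c : rat) (x : quat) := Quat (c * x1 x) (c * x2 x) (c * x3 x) (c * x4 x).

Lemma qnorm_mul x y : N (qmul x y) = N x * N y.
Proof. by rewrite /qnorm /=; ring. Qed.

Lemma qnorm_scale c x : N (qscale c x) = c ^+ 2 * N x.
Proof. by rewrite /qnorm /=; ring. Qed.

Lemma qnorm_conj x : N (qconj x) = N x.
Proof. by rewrite /qnorm /= !sqrrN. Qed.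

Let ratrE := (ratrD HF, ratrM HF, ratrN HF, ratrX HF).

Lemma rho_mul x y : rho (qmul x y) = rho x *m rho y.
Proof. by rewrite mul_mx2 /Defs.rho /= !ratrE -hs; congr mx2; ring. Qed.

Lemma rho_scale c x : rho (qscale c x) = ratr c *: rho x.
Proof. by rewrite scale_mx2 /Defs.rho /= !ratrE; congr mx2; ring. Qed.

Lemma det_rho x : \det (rho x) = ratr (N x).
Proof. by rewrite det_mx2 /qnorm !ratrE -hs; ring. Qed.

Lemma trace_rho x : \tr (rho x) = ratr (x1 x) *+ 2.
Proof. by rewrite trace_mx2; ring. Qed.

Lemma rho_one : rho qone = 1%:M.
Proof.
rewrite scalar_mx2 /Defs.rho /= (ratr0 F) (ratr1 F).
by rewrite !(mul0r, addr0, subr0, mulr0).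
Qed.

Lemma qnorm_one : N qone = 1.
Proof. by rewrite /qnorm /=; ring. Qed.

Lemma rho_unitmx x : N x != 0 -> rho x \in unitmx.
Proof. by move=> n0; rewrite unitmx2 det_rho; have [] := vratr HF n0. Qed.

Lemma normone_unitmx x : G x -> rho x \in unitmx.
Proof. by move=> Gx; apply: rho_unitmx; rewrite Gx oner_neq0. Qed.

Lemma det_normone x : G x -> \det (rho x) = 1.
Proof. by move=> Gx; rewrite det_rho Gx (ratr1 F). Qed.

Lemma normone_mul x y : G x -> G y -> G (qmul x y).
Proof. by rewrite /normone /= qnorm_mul => -> ->; rewrite mulr1. Qed.

Lemma normone_conj x : G x -> G (qconj x).
Proof. by rewrite /normone /= qnorm_conj. Qed.

Lemma rho_conj x : G x -> rho (qconj x) *m rho x = 1%:M.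
Proof.
move=> Gx; have e : ratr (N x) = 1 :> F by rewrite Gx (ratr1 F).
rewrite mul_mx2 scalar_mx2 -e /Defs.rho /= /qnorm !ratrE -hs.
by congr mx2; ring.
Qed.

Lemma act_rho_conj x X : G x -> act (rho (qconj x)) (act (rho x) X) = X.
Proof. by move=> Gx; rewrite act_mul rho_conj // act1. Qed.

(** Trace 0 means [x1 x = 0], and then [x^2 = - N(x) = -1]. *)
Lemma sqrt_of_trace0 x : G x -> \tr (rho x) = 0 -> sqrt_m1_in_D alpha beta.
Proof.
move=> Gx; rewrite trace_rho -mulr_natr => /eqP; rewrite mulf_eq0.
rewrite (negPf (natr_neq0 HF (n := 2) isT)) orbF => /eqP x10.
have {}x10 : x1 x = 0 by apply: (ratr_inj HF); rewrite x10 (ratr0 F).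
exists x; rewrite /qmone -[X in Quat (- X)]Gx /Defs.qmul /qnorm x10.
by congr Quat; ring.
Qed.

(** The element swaps [f (c - n)] and [f (c + n)]. Once the segment between them is moved to
    [sig 0, ..., sig (2 n)], [latclass_swap] bounds the valuation of the trace below by [n], for
    every [n]. *)
Lemma reflection_sqrt f x (c : int) : G x -> line p v f ->
  (forall n, act (rho x) (f n) = f (c + c - n)) -> sqrt_m1_in_D alpha beta.
Proof.
move=> Gx Lf H; have dx := det_normone Gx.
apply: (sqrt_of_trace0 Gx); apply: (vge_all (v := v)) => n.
have [h uh Hh] := line_path HF p_pr Lf (n + n)%N (c - n%:Z).
pose g := invmx h *m rho x *m h.
have dg : \det g = 1.
  by rewrite !det_mulmx dx mulr1 det_inv mulVf // -unitmx2.
have e0 := Hh 0%N isT; have e1 := Hh (n + n)%N (leqnn _).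
have f0 : c - n%:Z + 0%:Z = c - n%:Z by lia.
have f1 : c - n%:Z + (n + n)%N%:Z = c + n%:Z by lia.
rewrite {}f0 in e0; rewrite {}f1 in e1.
have s0 : V (g *m D 0%:Z) = V (D (n + n)%N%:Z).
  rewrite -act_sig -sig0E /g -!act_mul -e0 H.
  by rewrite -[RHS](actK _ uh) -e1; congr (act _ (f _)); lia.
have s1 : V (g *m D (n + n)%N%:Z) = V (D 0%:Z).
  rewrite -act_sig -sig0E /g -!act_mul -e1 H.
  by rewrite -[RHS](actK _ uh) -e0; congr (act _ (f _)); lia.
have [k ek] := latclass_swap HF p_pr dg s0 s1.
rewrite /g mxtrace_mulC mulmxA mulmxV // mul1mx.
by have -> : k = n%:Z by lia.
Qed.

(** For [beta = -1] the image of [e3] is [W diag(1, -1)], and the sign acts trivially on Sigma_0. *)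
Lemma reflection_e3 : beta = -1 -> exists2 x, G x &
  forall n, act (rho x) (sig n) = sig (- n).
Proof.
move=> hb; exists (Quat 0 0 1 0); first by rewrite /normone /= /qnorm /= hb; ring.
move=> n; have -> : rho (Quat 0 0 1 0) = mx2 0 1 1 0 *m mx2 1 0 0 (-1).
  rewrite mul_mx2 /Defs.rho /= hb (ratr0 F) (ratrN HF) (ratr1 F).
  by congr mx2; ring.
rewrite -act_mul act_diag ?oppr_eq0 ?oner_eq0 // (vN HF) subrr addr0.
exact: act_W.
Qed.

Definition edge (n : int) : set (vertex F) := [set sig n] `|` [set sig (n + 1)].

Lemma act_edge g (n : int) : act g @` edge n = [set act g (sig n)] `|` [set act g (sig (n + 1))].
Proof. by rewrite image_setU !image_set1. Qed.

Lemma image_Sigma0 g : act g @` Sigma0 p v = range (fun n => act g (sig n)).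
Proof. by rewrite image_comp. Qed.

(** An element taking the edge [{f 0, f 1}] of an apartment to [{f 1, f 2}] is either the
    translation by 1, excluded by parity, or the reflection about [f 1]. *)
Lemma strongly_transitive_sqrt AS : strongly_transitive p v (rho @` G) AS ->
  sqrt_m1_in_D alpha beta.
Proof.
move=> [[_ apt] _ trans].
have [_ sadj] := line_sig HF p_pr.
have C0 : chamber p v (edge 0) by exists (sig 0), (sig (0 + 1)); split.
(* One chamber taken twice: this only serves to produce a member of [AS]. *)
have [A [AA [f [Lf eA _]] _]] := apt _ _ C0 C0.
rewrite eA in AA.
have E n : apt_edge p v (range f) ([set f n] `|` [set f (n + 1)]).
  by apply/(apt_edgeP HF p_pr) => //; exists n.
have [_ [[x Gx <-] gA gC]] := trans _ _ _ _ AA (E 0) AA (E 1).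
have ug := normone_unitmx Gx.
have [|c Hc] := line_range HF p_pr Lf (line_act HF p_pr ug Lf).
  by rewrite -[X in _ `<=` X]gA image_comp.
have finj : injective f by case: Lf.
have im n : n = 0 \/ n = 1 -> exists m, act (rho x) (f n) = f m /\ (m = 1 \/ m = 2).
  move=> hn; have : (act (rho x) @` ([set f 0] `|` [set f (0 + 1)])) (act (rho x) (f n)).
    by exists (f n) => //; case: hn => ->; [left|right].
  by rewrite gC => -[->|->]; [exists 1|exists (1 + 1)]; split; auto.
have [m0 [e0 h0]] := im 0 (or_introl erefl).
have [m1 [e1 h1]] := im 1 (or_intror erefl).
case: Hc => Hc; rewrite !Hc in e0 e1; move/finj: e0 => e0; move/finj: e1 => e1; last first.
  by apply: (reflection_sqrt Gx Lf (c := 1)) => n; rewrite Hc; congr f; lia.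
have c1 : c = 1 by lia.
have [h uh Hh] := line_path HF p_pr Lf 1 0.
pose g := invmx h *m rho x *m h.
have dg : \det g = 1.
  by rewrite !det_mulmx det_normone // mulr1 det_inv mulVf // -unitmx2.
have : V (g *m D 0%:Z) = V (D 1%:Z).
  rewrite -act_sig -sig0E /g -!act_mul -Hh // Hc c1.
  by rewrite -[RHS](actK _ uh) -Hh.
by move=> /(latclass_parity HF p_pr dg)[k]; lia.
Qed.

(** * Approximation by norm-one quaternions *)

Hypothesis p_neq2 : p != 2%N.
Hypotheses (alpha0 : alpha != 0) (beta0 : beta != 0).
Hypotheses (va0 : vp p alpha = 0) (vb0 : vp p beta = 0).

Lemma v_2 : v 2%:R = 0.
Proof.
by rewrite (v_nat HF) // logn_prime // (negPf p_neq2).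
Qed.

Lemma s_neq0 : s != 0.
Proof.
by have [] := vratr HF alpha0; rewrite -hs expf_eq0 /=.
Qed.

Lemma v_s : v s = 0.
Proof.
have [_] := vratr HF alpha0; rewrite -hs va0 expr2 (vM HF) ?s_neq0 //.
move: (v s) => k; lia.
Qed.

(** The [a_i] approximate the coordinates of [w] in the basis [1, e2, e3, e4] of the matrix algebra
    over [F]; no precision is lost because [s] and [beta] are units. *)
Lemma rho_dense (w : 'M[F]_2) M : exists x, mxge v M (rho x - w).
Proof.
have [b0 vb] := vratr HF beta0; rewrite vb0 in vb.
have s0 := s_neq0; have t0 := natr_neq0 HF (n := 2) isT.
have app := fun y => rat_dense HF y M.
have [a1 h1] := app ((w 0 0 + w 1 1) / 2%:R).
have [a2 h2] := app ((w 0 0 - w 1 1) / (2%:R * s)).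
have [a3 h3] := app ((w 0 1 / ratr beta + w 1 0) / 2%:R).
have [a4 h4] := app ((w 0 1 / ratr beta - w 1 0) / (2%:R * s)).
have S x : vge v M x -> vge v M (x * s).
  by move=> h; apply: (vgeM_le HF _ h (vge_v _ _)); rewrite v_s; lia.
have B x : vge v M x -> vge v M (ratr beta * x).
  by move=> h; apply: (vgeM_le HF _ (vge_v _ _) h); rewrite vb; lia.
exists (Quat a1 a2 a3 a4); apply: mxge_mx2; rewrite !mxE /=; split.
- have -> : ratr a1 + ratr a2 * s - w 0 0 =
    (ratr a1 - (w 0 0 + w 1 1) / 2%:R) + (ratr a2 - (w 0 0 - w 1 1) / (2%:R * s)) * s.
    by field; rewrite s0 t0.
  by apply: (vgeD HF) => //; apply: S.
- have -> : ratr beta * (ratr a3 + ratr a4 * s) - w 0 1 =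
    ratr beta * ((ratr a3 - (w 0 1 / ratr beta + w 1 0) / 2%:R) +
      (ratr a4 - (w 0 1 / ratr beta - w 1 0) / (2%:R * s)) * s).
    by field; rewrite s0 t0 b0.
  by apply: B; apply: (vgeD HF) => //; apply: S.
- have -> : ratr a3 - ratr a4 * s - w 1 0 =
    (ratr a3 - (w 0 1 / ratr beta + w 1 0) / 2%:R) -
      (ratr a4 - (w 0 1 / ratr beta - w 1 0) / (2%:R * s)) * s.
    by field; rewrite s0 t0 b0.
  by apply: (vgeB HF) => //; apply: S.
have -> : ratr a1 - ratr a2 * s - w 1 1 =
    (ratr a1 - (w 0 0 + w 1 1) / 2%:R) - (ratr a2 - (w 0 0 - w 1 1) / (2%:R * s)) * s.
  by field; rewrite s0 t0.
by apply: (vgeB HF) => //; apply: S.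
Qed.

(** If [rho x = w (1 + E1)], then its square is [w^2 (1 + E2) (1 + E1)] with [E2 = w^-1 E1 w]; for
    [x] close to [w] both factors fix the segment by [congr_fixes]. *)
Lemma approx_square (w : 'M[F]_2) (M : int) : w \in unitmx -> 1 <= M ->
  exists2 x, N x != 0 &
    forall n, - M <= n <= M -> act (rho x *m rho x) (sig n) = act (w *m w) (sig n).
Proof.
move=> uw M1.
have [a ha] := small_mul HF (invmx w) 1%:M M.
have [b hb] := small_mul HF (invmx w *m invmx w) w M.
have [x hx] := rho_dense w (Num.max a b).
have hxa : mxge v a (rho x - w) by move=> i j; apply: vge_le (hx i j); lia.
have hxb : mxge v b (rho x - w) by move=> i j; apply: vge_le (hx i j); lia.
move: (ha _ hxa) (hb _ hxb); set E1 := _ *m 1%:M; set E2 := _ *m w => h1 h2.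
have e1 : rho x = w *m (1%:M + E1).
  by rewrite mulmxDr mulmx1 /E1 mulmx1 mulKVmx // addrC subrK.
have e2 : rho x *m rho x = w *m w *m ((1%:M + E2) *m (1%:M + E1)).
  have -> : 1%:M + E2 = invmx w *m (1%:M + E1) *m w.
    by rewrite mulmxDr mulmxDl mulmx1 mulVmx // /E1 /E2 mulmx1 !mulmxA.
  by rewrite {1 2}e1 -!mulmxA mulKVmx.
exists x.
  have M0 : - M <= 0 <= M by lia.
  have [u1 _] := congr_fixes HF p_pr M1 M0 h1.
  have : rho x \in unitmx by rewrite e1 unitmx_mul uw u1.
  rewrite unitmx2 det_rho; apply: contra => /eqP ->; by rewrite (ratr0 F).
move=> n hn.
have [_ f1] := congr_fixes HF p_pr M1 hn h1.
have [_ f2] := congr_fixes HF p_pr M1 hn h2.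
by rewrite e2 -(act_mul (w *m w)) -(act_mul (1%:M + E2)) f1 f2.
Qed.

(* Cayley-Hamilton gives [(1 + h)^2 = (tr h + 2) h] when [det h = 1], so [h]
   acts on the tree as the square of [1 + h]; squares of rational quaternions
   can be normalised to norm one. *)
Lemma approx_SL2 (h : 'M[F]_2) (M : int) : \det h = 1 -> 1 <= M ->
  exists2 x, G x & forall n, - M <= n <= M -> act (rho x) (sig n) = act h (sig n).
Proof.
move=> dh M1.
(* When the trace is -2, [h] is replaced by [- h], which acts in the same way and has trace 2. The
   quantity [tr h + 2] is also [det (1 + h)]. *)
wlog th : h dh / \tr h + 2%:R != 0.
  move=> H; have [t0|] := eqVneq (\tr h + 2%:R) 0; last exact: H.
  have [||x Gx Hx] := H (- h).
  - by rewrite det_mx2E !mxE -[RHS]dh det_mx2E; ring.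
  - have -> : \tr (- h) + 2%:R = 2%:R * 2%:R.
      have -> : \tr (- h) = - \tr h by exact: raddfN.
      have -> : \tr h = - 2%:R by apply/eqP; rewrite -addr_eq0 t0.
      by ring.
    by rewrite mulf_neq0 // (natr_neq0 HF (n := 2)).
  exists x => // n hn; rewrite Hx // !act_sig -scaleN1r -scalemxAl latclassZ //.
  by rewrite oppr_eq0 oner_eq0.
pose w := 1%:M + h.
have dE : h 0 0 * h 1 1 - h 0 1 * h 1 0 = 1 by rewrite -det_mx2E.
have tE : \tr h = h 0 0 + h 1 1 by rewrite {1}(mx2_eta h) trace_mx2.
have uw : w \in unitmx.
  rewrite unitmx2 /w (mx2_eta h) scalar_mx2 add_mx2 det_mx2.
  set d := (X in X != 0); have -> : d = \tr h + 2%:R.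
    rewrite tE (_ : 2%:R = 1 + 1) // -{2}dE /d; ring.
  exact: th.
have w2 : w *m w = (\tr h + 2%:R) *: h.
  have bc : h 0 1 * h 1 0 = h 0 0 * h 1 1 - 1 by rewrite -dE; ring.
  rewrite tE /w [h in RHS]mx2_eta [in LHS](mx2_eta h) scalar_mx2 add_mx2 mul_mx2 scale_mx2 !mx2E.
  congr mx2.
  - by rewrite !add0r bc; ring.
  - by ring.
  - by ring.
  - by rewrite !add0r (mulrC (h 1 0)) bc; ring.
have [x n0 Hx] := approx_square uw M1.
exists (qscale (N x)^-1 (qmul x x)).
  by rewrite /normone /= qnorm_scale qnorm_mul; field.
move=> n hn; have c0 : ratr (N x)^-1 != 0 :> F by apply: (ratr_neq0 HF); rewrite invr_eq0.
by rewrite act_sig rho_scale -scalemxAl latclassZ // rho_mul -act_sig Hx //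
  w2 act_sig -scalemxAl latclassZ // act_sig.
Qed.

(** [rho y] is diagonal with entries [q + s] of positive valuation and [q - s], a unit as [p] is
    odd. Passing to [y^2 / N(y)] gives norm one and doubles the shift. *)
Lemma translation_nat (m : nat) : exists2 x, G x &
  forall n, act (rho x) (sig n) = sig (n - m%:Z *+ 2).
Proof.
(* For [m = 0] the entry [q - s] need not be a unit, but the identity does. *)
case: m => [|m].
  exists qone; first exact: qnorm_one.
  by move=> n; rewrite rho_one act1 subr0.
have s0 := s_neq0; have t0 := natr_neq0 HF (n := 2) isT.
(* The extra 1 in the precision makes [p^(m+1)] dominate the error. *)
have [q hq] := rat_dense HF (p%:R ^ m.+1%:Z - s) (m.+1%:Z + 1).
pose u := ratr q + s; pose u' := ratr q - s.
have [u0 vu] : u != 0 /\ v u = m.+1%:Z.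
  have -> : u = p%:R ^ m.+1%:Z + (ratr q - (p%:R ^ m.+1%:Z - s)) by rewrite /u; ring.
  rewrite -[X in v _ = X](v_piX HF p_pr); apply: (v_dominant HF).
    exact: piX_neq0 HF p_pr _.
  by rewrite (v_piX HF p_pr).
have [u'0 vu'] : u' != 0 /\ v u' = 0.
  have v2s : v (- (2%:R * s)) = 0 by rewrite (vN HF) (vM HF) // v_2 v_s.
  have -> : u' = - (2%:R * s) + u by rewrite /u /u'; ring.
  rewrite -[X in v _ = X]v2s; apply: (v_dominant HF); first by rewrite oppr_eq0 mulf_neq0.
  by right; rewrite v2s vu; lia.
pose y := Quat q 1 0 0.
have ry : rho y = mx2 u 0 0 u'.
  by rewrite /Defs.rho /= (ratr0 F) (ratr1 F) /u /u'; congr mx2; ring.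
have ny : N y != 0.
  by apply: contraTneq isT => e; move: (det_rho y); rewrite ry det_mx2 e (ratr0 F)
    mulr0 subr0 => /eqP; rewrite mulf_eq0 (negPf u0) (negPf u'0).
exists (qscale (N y)^-1 (qmul y y)).
  by rewrite /normone /= qnorm_scale qnorm_mul; field.
move=> n; have c0 : ratr (N y)^-1 != 0 :> F by apply: (ratr_neq0 HF); rewrite invr_eq0.
rewrite act_sig rho_scale -scalemxAl latclassZ // rho_mul -act_sig ry -act_mul !act_diag // vu vu'.
congr (sig _); lia.
Qed.

Lemma translation (k : int) : exists2 x, G x &
  forall n, act (rho x) (sig n) = sig (n + (k + k)).
Proof.
have [x Gx Hx] := translation_nat (absz k).
have [k0|k0] := lerP 0 k; last first.
  by exists x => // n; rewrite Hx; congr (sig _); lia.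
exists (qconj x) => [|n]; first exact: normone_conj.
have -> : sig n = act (rho x) (sig (n + (k + k))) by rewrite Hx; congr (sig _); lia.
exact: act_rho_conj.
Qed.

Lemma edge_transitive (m m' : int) : beta = -1 -> exists x,
  [/\ G x, act (rho x) @` Sigma0 p v = Sigma0 p v & act (rho x) @` edge m = edge m'].
Proof.
move=> hb.
have stab g (t : int -> int) : (forall n, act g (sig n) = sig (t n)) ->
    (forall n, t (t n) = n) \/ (exists c, forall n, t n = n + c) ->
    act g @` Sigma0 p v = Sigma0 p v.
  move=> H tt; rewrite image_Sigma0; apply/seteqP; split=> [_ [n _ <-]|_ [n _ <-]].
    by rewrite H; exists (t n).
  have [i <-] : exists i, t i = n.
    case: tt => [tt|[c tc]]; first by exists (t n).
    by exists (n - c); rewrite tc subrK.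
  by exists i.
have [k [ek|ek]] : exists k : int, m' - m = k + k \/ m' - m = k + k + 1.
  by exists ((m' - m) %/ 2)%Z; lia.
- have [x Gx Hx] := translation k.
  exists x; split=> //; first by apply: (stab _ _ Hx); right; exists (k + k).
  by rewrite act_edge !Hx /edge; congr ([set sig _] `|` [set sig _]); lia.
(* An odd shift needs a reflection: [n] goes to [2 (k + m + 1) - n], which sends [m] to [m' + 1] and
   [m + 1] to [m']. *)
have [x Gx Hx] := translation (k + m + 1).
have [y Gy Hy] := reflection_e3 hb.
exists (qmul x y); have H n : act (rho (qmul x y)) (sig n) = sig (- n + (k + m + 1 + (k + m + 1))).
  by rewrite rho_mul -act_mul Hy Hx.
split; first exact: normone_mul.
  by apply: (stab _ _ H); left => n; lia.
by rewrite act_edge !H /edge setUC; congr ([set sig _] `|` [set sig _]); lia.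
Qed.

(** * The orbit of Sigma_0 as an apartment system *)

Definition translates : set (set (vertex F)) :=
  [set A | exists2 x, G x & A = act (rho x) @` Sigma0 p v].

Lemma line_translate x : G x -> line p v (fun n => act (rho x) (sig n)).
Proof.
by move=> Gx; apply: line_act => //; [exact: normone_unitmx|exact: line_sig].
Qed.

Lemma translates_system : apartment_system p v translates.
Proof.
split=> [A [x Gx ->]|C C' [X [Y [XY ->]]] [X' [Y' [XY' ->]]]].
  rewrite image_Sigma0; exists (fun n => act (rho x) (sig n)); split=> //.
  exact: line_translate.
have [h [a [b [dh ea eb]]]] := two_chambers HF p_pr XY XY'.
(* The margin of 1 covers the neighbours of [a] and [b] that complete the two edges. *)
pose M : int := Num.max (`|a| + 1) (`|b| + 1).
have [|x Gx Hx] := approx_SL2 dh (M := M); first by rewrite /M; lia.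
have on Z T (n : int) : `|n| + 1 <= M -> on_edge p v h Z T n ->
    apt_edge p v (act (rho x) @` Sigma0 p v) ([set Z] `|` [set T]).
  move=> nM [-> eT]; rewrite image_Sigma0; apply/(apt_edgeP HF p_pr).
    exact: line_translate.
  case: eT => ->; [exists n|exists (n - 1)]; first by rewrite !Hx //; lia.
  by rewrite subrK setUC !Hx //; lia.
exists (act (rho x) @` Sigma0 p v); split; first by exists x.
- by apply: (on _ _ _ _ ea); rewrite /M; lia.
- by apply: (on _ _ _ _ eb); rewrite /M; lia.
Qed.

Lemma translates_strongly_transitive : beta = -1 ->
  strongly_transitive p v (rho @` G) translates.
Proof.
move=> hb; split; first exact: translates_system.
  move=> _ _ [x Gx <-] [y Gy ->]; exists (qmul x y); first exact: normone_mul.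
  by rewrite image_comp rho_mul; apply: eq_imagel => Z _; rewrite /= act_mul.
move=> _ C _ C' [x Gx ->] + [x' Gx' ->].
rewrite !image_Sigma0 => /(apt_edgeP HF p_pr _ (line_translate Gx))[m ->].
move=> /(apt_edgeP HF p_pr _ (line_translate Gx'))[m' ->].
have [t [Gt tS te]] := edge_transitive m m' hb.
have rE X : act (rho (qmul x' (qmul t (qconj x)))) (act (rho x) X) =
    act (rho x') (act (rho t) X).
  by rewrite !rho_mul -!act_mul act_rho_conj.
exists (rho (qmul x' (qmul t (qconj x)))); split.
- exists (qmul x' (qmul t (qconj x))) => //.
  by do !apply: normone_mul => //; apply: normone_conj.
- rewrite -!image_Sigma0 -[in RHS]tS !image_comp; apply: eq_imagel => X _ /=.
  exact: rE.
rewrite -!act_edge -te !image_comp; apply: eq_imagel => X _ /=.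
exact: rE.
Qed.

End Quaternions.

Theorem theorem2 (p : nat) (F : fieldType) (v : F -> int)
    (alpha beta : rat) (s : F) :
  prime p -> p != 2%N -> padic_field p v ->
  alpha != 0 -> beta != 0 -> quat_division alpha beta ->
  vp p alpha = 0 -> vp p beta = 0 ->
  s ^+ 2 = ratr alpha ->
  (sqrt_m1_in_D alpha beta -> beta = -1) ->
  (sqrt_m1_in_D alpha beta <->
     (exists x, [/\ normone alpha beta x,
        act (rho beta s x) @` Sigma0 p v = Sigma0 p v &
        exists c : int, forall n : int,
          act (rho beta s x) (sig0 p v n) = sig0 p v (c - n)])) /\
  (sqrt_m1_in_D alpha beta <->
     exists AS : set (set (vertex F)),
       strongly_transitive p v (rho beta s @` normone alpha beta) AS).
Proof.
move=> p_pr p2 HF alpha0 beta0 _ va0 vb0 hs hb.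
split; split.
- move=> /hb b1; have [x Gx Hx] := reflection_e3 alpha s HF p_pr b1.
  exists x; split=> //; last by exists 0 => n; rewrite Hx sub0r.
  rewrite image_Sigma0; apply/seteqP; split=> [_ [n _ <-]|_ [n _ <-]].
    by rewrite Hx; exists (- n).
  by exists (- n) => //; rewrite Hx opprK.
- move=> [x [Gx _ [c Hc]]].
  (* Since [sig 0] goes to [sig c], the integer [c] is even, and the reflection fixes the vertex
     with index [c / 2]. *)
  have [|k ek] := latclass_parity HF p_pr (m := 0) (n := c) (det_normone HF hs Gx).
    by rewrite -act_sig Hc subr0.
  apply: (reflection_sqrt HF p_pr hs Gx (line_sig HF p_pr) (c := k)) => n.
  by rewrite Hc; congr (sig0 _ _ _); lia.
- move=> /hb b1; exists (translates p v alpha beta s).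
  exact: translates_strongly_transitive.
- by move=> [AS /(strongly_transitive_sqrt HF p_pr hs)].
Qed.
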